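(* Let $f(x;w)$ be a ResNet or a DenseNet (as defined in the context), with all weights i.i.d. standard normal, evaluated at a fixed input $x$ with $\|x\|_2=1$. For every weight matrix $W^{\mathbf{k}}$ of the network, with $J^{\mathbf{k}}=\frac{\partial f(x;w)}{\partial W^{\mathbf{k}}}$ and $\|\cdot\|_2$ the Frobenius norm: 1. $\mathbb{E}_w\big[\|J^{\mathbf{k}}\|_2^2\big]=\mathbb{E}_w\big[(f_{(\mathbf{k})}(x;w))^2\big]$; 2. $\frac{1}{3}\mathbb{E}_w\big[(f_{(\mathbf{k})}(x;w))^4\big]\le\mathbb{E}_w\big[\|J^{\mathbf{k}}\|_2^4\big]\le\mathbb{E}_w\big[(f_{(\mathbf{k})}(x;w))^4\big]$.
   Context: $\phi(t)=\max(0,t)$ is the ReLU, applied coordinatewise. All weight entries are i.i.d. $\mathcal{N}(0,1)$. ResNet with residual branches of depth $m_b$: $f(x;w)=\frac{1}{\sqrt{n_L}}W^{L}y^L$ with final projection $W^{L}$ a row vector (distinct from the branch matrices $W^{L,h}$); $y^0=\frac{1}{\sqrt{n_0}}W^0x$; for $l\in[L]$, $y^l=y^{l-1}+\sqrt{\alpha_l}\,y^{l-1,m_b}$, where $y^{l-1,1}=\frac{1}{\sqrt{n_{l-1}}}W^{l,1}y^{l-1}$, $y^{l-1,h}=\frac{1}{\sqrt{n_{l-1,h-1}}}W^{l,h}q^{l-1,h-1}$ for $1<h\le m_b$, and $q^{l-1,h}=\sqrt2\,\phi(y^{l-1,h})$; $\alpha_l>0$, $n_{l-1,h}$ is the dimension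 of $y^{l-1,h}$, $n_l$ that of $y^l$, and dimensions are compatible (all $y^l$ have the same dimension). DenseNet: $f(x;w)=\frac{1}{\sqrt{n_L}}W^{L}y^L$ (final row-vector projection $W^L$); $y^0=\frac{1}{\sqrt{n_0}}W^0x$; for $l\in[L]$, $y^l=\sqrt{\frac{\alpha}{n_{l-1}\,l}}\sum_{h=0}^{l-1}W^{l,h}q^h$ with $q^h=\sqrt2\,\phi(y^h)$, $\alpha>0$, and $W^{l,h}$ having $n_l$ rows and as many columns as the dimension of $q^h$. Reduced network $f_{(\mathbf{k})}(x;w)$: the network obtained from $f$ by removing all connections bypassing $W^{\mathbf{k}}$ (same weights, recomputed activations). Concretely, for a ResNet and $\mathbf{k}=(l_k,h)$ a branch matrix, the recursion at layer $l_k$ becomes $y^{l_k}=\sqrt{\alpha_{l_k}}\,y^{l_k-1,m_b}$ (identity term dropped), all else unchanged; for a DenseNet and $\mathbf{k}=(l_k,h_k)$, $y^{l_k}=\sqrt{\frac{\alpha}{n_{l_k-1}l_k}}W^{l_k,h_k}q^{h_k}$ and for $l>l_k$, $y^l=\sqrt{\frac{\alpha}{n_{l-1}l}}\sum_{h=l_k}^{l-1}W^{l,h}q^h$; for the first and last projections $W^0,W^L$ nothing is removed. *)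

(* Defs.v *)
From HB Require Import structures.
From mathcomp Require Import all_boot all_order all_algebra.
From mathcomp Require Import all_classical all_reals all_analysis.
Set Implicit Arguments.
Unset Strict Implicit.
Unset Printing Implicit Defensive.
Import Order.TTheory GRing.Theory Num.Theory.
Local Open Scope ring_scope.

(* Weight keys: W^0 (first projection), W^{l,h} (inner matrices), W^L (final *)
(* row-vector projection).                                                   *)
Inductive wkey := WIn | WMid of nat & nat | WOut.

Definition wkey_code (k : wkey) : option (option (nat * nat)) :=
  match k with WIn => None | WMid l h => Some (Some (l, h)) | WOut => Some None end.
Definition wkey_decode (c : option (option (nat * nat))) : wkey :=
  match c with None => WIn | Some (Some (l, h)) => WMid l h | Some None => WOut end.
Lemma wkey_codeK : cancel wkey_code wkey_decode. Proof. by case. Qed.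
HB.instance Definition _ := Countable.copy wkey (can_type wkey_codeK).

Section Nets.
Variable R : realType.

(* Network weights: entry (i, j) of matrix W^k is  w k i j  (0-based).       *)
Definition weights := wkey -> nat -> nat -> R.
(* Vectors are represented as functions nat -> R (only the first d entries  *)
(* of a d-dimensional vector are meaningful).                                *)
Definition vec := nat -> R.

Definition lin (w : weights) (k : wkey) (c : nat) (v : vec) : vec :=
  fun i => \sum_(j < c) w k i j * v j.

Definition scalev (a : R) (v : vec) : vec := fun i => a * v i.

Definition relu (t : R) : R := Num.max 0 t.
Definition q_of (v : vec) : vec := fun i => Num.sqrt 2 * relu (v i).

Definition upd (w : weights) (c : wkey * nat * nat) (t : R) : weights :=
  fun k i j => if (k, i, j) == c then t else w k i j.

Definition mcoords (k : wkey) (r c : nat) : seq (wkey * nat * nat) :=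
  [seq (k, i, j) | i <- iota 0 r, j <- iota 0 c].

(* Expectation over i.i.d. N(0,1) entries at the listed coordinates, written *)
(* as an iterated integral against the standard normal law (the integrands  *)
(* considered are nonnegative, so this is the product-measure expectation   *)
(* by Tonelli).                                                             *)
Fixpoint gauss_iter (s : seq (wkey * nat * nat)) (F : weights -> \bar R)
  (w : weights) : \bar R :=
  match s with
  | [::] => F w
  | c :: s' => (\int[normal_prob (0 : R) 1]_t gauss_iter s' F (upd w c t))%E
  end.

Definition gaussE (s : seq (wkey * nat * nat)) (F : weights -> \bar R) : \bar R :=
  gauss_iter s F (fun _ _ _ => 0).

Definition jac_sqnorm (f : weights -> R) (w : weights) (k : wkey) (r c : nat) : R :=
  \sum_(i < r) \sum_(j < c)
     (derive1 (fun t => f (upd w (k, (i : nat), (j : nat)) t)) (w k i j)) ^+ 2.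

(* ResNet.  d = dim x, n = common dimension of all y^l (so n_l = n),         *)
(* L blocks, branch depth mb, nb l h = n_{l-1,h} for 0 < h < mb,            *)
(* alpha l = alpha_l.                                                        *)
(* dimension of y^{l-1,h}; h = 0 stands for the branch input y^{l-1}. *)
Definition rdim (n mb : nat) (nb : nat -> nat -> nat) (l h : nat) : nat :=
  if (h == 0%N) || (h == mb) then n else nb l h.

(* y^{l-1,h} computed from the branch input v = y^{l-1}, for h >= 1. *)
Fixpoint rbranch (n mb : nat) (nb : nat -> nat -> nat) (w : weights) (l h : nat)
  (v : vec) : vec :=
  match h with
  | 0 => v
  | h'.+1 =>
    if h' == 0%N then scalev (Num.sqrt n%:R)^-1 (lin w (WMid l 1) n v)
    else scalev (Num.sqrt (rdim n mb nb l h')%:R)^-1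
           (lin w (WMid l h) (rdim n mb nb l h')
              (q_of (rbranch n mb nb w l h' v)))
  end.

Fixpoint resnet_y (d n mb : nat) (nb : nat -> nat -> nat) (alpha : nat -> R)
  (red : option nat) (x : vec) (w : weights) (l : nat) : vec :=
  match l with
  | 0 => scalev (Num.sqrt n%:R)^-1 (lin w WIn d x)
  | l'.+1 =>
    let yp := resnet_y d n mb nb alpha red x w l' in
    fun i => (if red == Some l then 0 else yp i)
             + Num.sqrt (alpha l) * rbranch n mb nb w l mb yp i
  end.

Definition resnet_out (d n L mb : nat) (nb : nat -> nat -> nat) (alpha : nat -> R)
  (red : option nat) (x : vec) (w : weights) : R :=
  (Num.sqrt n%:R)^-1 * \sum_(j < n) w WOut 0%N j * resnet_y d n mb nb alpha red x w L j.

Definition resnet d n L mb nb alpha x := resnet_out d n L mb nb alpha None x.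

Definition resnet_red d n L mb nb alpha (k : wkey) x :=
  match k with
  | WMid l _ => resnet_out d n L mb nb alpha (Some l) x
  | _ => resnet_out d n L mb nb alpha None x
  end.

(* Weight matrices of the ResNet: key, rows, columns. *)
Definition resnet_mats (d n L mb : nat) (nb : nat -> nat -> nat) :
  seq (wkey * nat * nat) :=
  [:: (WIn, n, d)] ++
  [seq (WMid l h, rdim n mb nb l h, rdim n mb nb l h.-1)
     | l <- iota 1 L, h <- iota 1 mb] ++
  [:: (WOut, 1%N, n)].

Definition all_coords (mats : seq (wkey * nat * nat)) : seq (wkey * nat * nat) :=
  flatten [seq mcoords m.1.1 m.1.2 m.2 | m <- mats].

(* DenseNet.  d = dim x, nd l = n_l = dim y^l (0 <= l <= L).                  *)
Definition dkeep (red : option (nat * nat)) (l h : nat) : bool :=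
  match red with
  | None => true
  | Some (lk, hk) => if (l < lk)%N then true else if l == lk then h == hk
                     else (lk <= h)%N
  end.

Fixpoint densenet_ys (d : nat) (nd : nat -> nat) (alpha : R)
  (red : option (nat * nat)) (x : vec) (w : weights) (l : nat) : seq vec :=
  match l with
  | 0 => [:: scalev (Num.sqrt (nd 0%N)%:R)^-1 (lin w WIn d x)]
  | l'.+1 =>
    let ys := densenet_ys d nd alpha red x w l' in
    rcons ys
      (fun i => Num.sqrt (alpha / ((nd l')%:R * l%:R)) *
         \sum_(h < l | dkeep red l h)
            lin w (WMid l h) (nd h) (q_of (nth (fun _ => 0) ys h)) i)
  end.

Definition densenet_out (d L : nat) (nd : nat -> nat) (alpha : R)
  (red : option (nat * nat)) (x : vec) (w : weights) : R :=
  (Num.sqrt (nd L)%:R)^-1 * \sum_(j < nd L)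
     w WOut 0%N j * nth (fun _ => 0) (densenet_ys d nd alpha red x w L) L j.

Definition densenet d L nd alpha x := densenet_out d L nd alpha None x.

Definition densenet_red d L nd alpha (k : wkey) x :=
  match k with
  | WMid l h => densenet_out d L nd alpha (Some (l, h)) x
  | _ => densenet_out d L nd alpha None x
  end.

Definition densenet_mats (d L : nat) (nd : nat -> nat) : seq (wkey * nat * nat) :=
  [:: (WIn, nd 0%N, d)] ++
  [seq (WMid l h, nd l, nd h) | l <- iota 1 L, h <- iota 0 l] ++
  [:: (WOut, 1%N, nd L)].

Definition jacobian_moments (coords : seq (wkey * nat * nat))
  (f fk : weights -> R) (k : wkey) (r c : nat) : Prop :=
  (gaussE coords (fun w => (jac_sqnorm f w k r c)%:E)
     = gaussE coords (fun w => (fk w ^+ 2)%:E))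
  /\ ((3^-1)%:E * gaussE coords (fun w => (fk w ^+ 4)%:E)
        <= gaussE coords (fun w => (jac_sqnorm f w k r c ^+ 2)%:E))%E
  /\ (gaussE coords (fun w => (jac_sqnorm f w k r c ^+ 2)%:E)
        <= gaussE coords (fun w => (fk w ^+ 4)%:E))%E.

End Nets.

(* Main.v *)
(* Let G be a Gaussian matrix independent of the weights w. Given w, the       *)
(* directional derivative <J, G> of f along G in W^k is centred normal with   *)
(* variance |J|^2, so E <J, G>^2 = E |J|^2 and E <J, G>^4 = 3 E |J|^4.         *)
(*                                                                            *)
(* <J, G> is the output of the reduced network in which G replaces W^k and    *)
(* each ReLU gate is opened by the pre-activation z of the full network       *)
(* instead of the pre-activation v of the reduced one. Going from the top     *)
(* down, the gates can be exchanged one unit at a time: reverse the incoming  *)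
(* row and the outgoing columns of the unit whenever z v < 0. Reversing the   *)
(* row changes the signs of z and v together, so this preserves the law of    *)
(* the weights, it makes the sign of v agree with the former sign of z, and   *)
(* the reversed columns hide the change from the layers above. Hence <J, G>   *)
(* has the law of f_(k), and E f_(k)^4 = 3 E |J|^4 holds exactly.             *)
(*                                                                            *)
(* Exceptional weights, where z = 0 but v <> 0 for some unit, form a null set *)
(* because z is then an affine function of some weight with nonzero slope.    *)
(* Off this set f is locally affine in each entry of W^k.                     *)

(* Both architectures are instances ([dnet], [rnet]) of one layered network [net] with scalar output
   [pre N x w M 0], and [net_jacobian_moments] treats all its matrices at once. The Gaussian matrix
   G is an extra weight matrix with key [kaux]. A single recursion [tang] interpolates between the
   two sides: with no gate exchanged it is the linear form $\langle J, G\rangle$ ([vout_aux]); with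
   all gates exchanged it is the reduced network reading G for $W^k$, and renaming [kaux] turns this
   into $f_{(k)}$ ([gaussE_redout]).

   The two ends have the same law ([gaussE_none_all]), by a chain of exchanges of one unit each
   ([gaussE_align]). Each exchange is a sign flip applied on an event that the flip leaves invariant
   ([gaussE_cond_flip]). The moments of a Gaussian linear form ([gauss_iter_linear_sqr],
   [gauss_iter_linear_exp4]) then give $E f_{(k)}^2 = E|J|^2$ and $E f_{(k)}^4 = 3 E|J|^4$; the
   bounds of the theorem follow from $1 \le 3$.

   That J is the true derivative holds off a null set ([null_bad]): there no ReLU kink is met with
   nonzero speed ([good_tang]), so the network is affine near the given value of each single weight
   of the matrix ([pre_near]). *)
Require Import Defs.
From HB Require Import structures.
From mathcomp Require Import all_boot all_order all_algebra.
From mathcomp Require Import all_classical all_reals all_analysis.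
From mathcomp Require Import measurable_realfun ring lra zify.
Import Order.TTheory GRing.Theory Num.Theory.
Import numFieldNormedType.Exports.
Local Open Scope ring_scope.
Local Open Scope classical_set_scope.
Set Implicit Arguments.
Unset Strict Implicit.
Unset Printing Implicit Defensive.

(** * The standard normal law *)

Section StandardNormal.
Variable R : realType.
Local Notation mu := (@lebesgue_measure R).
Local Notation gam := (normal_prob (0 : R) 1).
Local Notation phi := (normal_pdf (0 : R) 1).

(** The Radon-Nikodym derivative of the law agrees almost everywhere with the density, both having
    the same integral over every measurable set. *)
Lemma ge0_integral_normal_prob (f : R -> \bar R) :
  measurable_fun setT f -> (forall t, 0 <= f t)%E ->
  (\int[gam]_t f t = \int[mu]_t (f t * (phi t)%:E))%E.
Proof.
move=> mf f0.
have dom := @normal_prob_dominates R 0 1.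
have intf := Radon_Nikodym_SigmaFinite.f_integrable dom.
rewrite -(Radon_Nikodym_SigmaFinite.change_of_variables dom)//.
have mphi : measurable_fun setT (fun t => (phi t)%:E).
  by apply/measurable_EFinP; exact: measurable_normal_pdf.
apply: ae_eq_integral => //.
- by apply: emeasurable_funM => //; exact: measurable_int intf.
- exact: emeasurable_funM.
- apply: ae_eqe_mul2l; apply: integral_ae_eq => // E _ mE.
  by rewrite -Radon_Nikodym_SigmaFinite.f_integral.
Qed.

Lemma normal_pdf01E t : phi t = normal_peak 1 * expR (- (t ^+ 2 / 2)).
Proof.
rewrite normal_pdfE ?oner_neq0// /normal_fun subr0 expr1n mulNr.
by rewrite -mulr_natr mul1r.
Qed.

Lemma normal_pdf01N t : phi (- t) = phi t.
Proof. by rewrite !normal_pdf01E sqrrN. Qed.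

Lemma ge0_integral_normalN (f : R -> \bar R) :
  measurable_fun setT f -> (forall t, 0 <= f t)%E ->
  (\int[gam]_t f (- t)%R = \int[gam]_t f t)%E.
Proof.
move=> mf f0.
have mphi : measurable_fun setT (fun t => (phi t)%:E).
  by apply/measurable_EFinP; exact: measurable_normal_pdf.
rewrite !ge0_integral_normal_prob//; last exact: measurableT_comp.
pose g t := (f t * (phi t)%:E)%E.
transitivity (\int[mu]_t (g \o -%R) t)%E.
  by apply: eq_integral => t _; rewrite /g /= normal_pdf01N.
have mg : measurable_fun setT g by exact: emeasurable_funM.
pose opp := (-%R : measurableTypeR R -> measurableTypeR R).
have mopp : measurable_fun setT opp by exact: oppr_measurable.
have g0 : {in setT, forall t, 0 <= g t}%E.
  by move=> y _; rewrite mule_ge0// lee_fin normal_pdf_ge0.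
have := @ge0_integral_pushforward _ _ _ _ _ opp mopp mu setT g measurableT mg g0.
rewrite preimage_setT => <-.
by apply: eq_measure_integral => A mA _; exact: lebesgue_measureN.
Qed.

Lemma normal_prob_set1 (a : R) : gam [set a] = 0%E.
Proof.
have /null_content_dominatesP dom := @normal_prob_dominates R 0 1.
by apply: dom => //; exact: lebesgue_measure_set1.
Qed.

Lemma continuous_normal_pdf01 : continuous phi.
Proof. by apply: continuous_normal_pdf; rewrite oner_neq0. Qed.

Lemma is_derive_normal_pdf01 (x : R) : is_derive x 1 phi (- (x * phi x)).
Proof.
have -> : phi = fun t : R => normal_peak 1 * expR (- (t ^+ 2 / 2)).
  by apply/funext => t; rewrite normal_pdf01E.
apply: is_derive_eq.
by rewrite /GRing.scale/=; field.
Qed.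

Lemma is_derive_monomial_pdf n (x : R) :
  is_derive x 1 (fun t : R => t ^+ n.+1 * phi t)
    (n.+1%:R * (x ^+ n * phi x) - x ^+ n.+2 * phi x).
Proof.
have ? := is_derive_normal_pdf01 x.
have -> : (fun t : R => t ^+ n.+1 * phi t) = (id ^+ n.+1) * phi.
  by apply/funext => t; rewrite !fctE.
apply: is_derive_eq.
by rewrite /GRing.scale/= !fctE mulr1 !exprS; ring.
Qed.

(** From $e^y \ge 1 + y^2/2$ at $y = x^2/2$ comes $e^{-x^2/2} \le 8/x^4$, enough to beat $x^3$, the
    largest boundary term met on the way to the fourth moment. *)
Lemma monomial_pdf_le n (x : R) : (n < 4)%N -> 1 <= x ->
  x ^+ n * phi x <= normal_peak 1 * 8 / x.
Proof.
move=> n4 x1; have x0 : 0 < x by rewrite (lt_le_trans _ x1).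
have peak0 : 0 < normal_peak (1 : R) by rewrite normal_peak_gt0 ?oner_neq0.
rewrite normal_pdf01E mulrCA -mulrA ler_pM2l//.
have h : x ^+ n <= x ^+ 3 by rewrite ler_weXn2l// -ltnS.
apply: (le_trans (ler_wpM2r (expR_ge0 _) h)).
have x2 : 0 <= x ^+ 2 / 2 by rewrite divr_ge0// sqr_ge0.
have := @expR_ge1Dxn R _ 1 x2; rewrite expRN => ex.
rewrite ler_pdivrMr ?expR_gt0//.
apply: le_trans (ler_wpM2l _ ex); last by rewrite divr_ge0// ltW.
rewrite mulrAC ler_pdivlMr//.
have -> : (1 + (x ^+ 2 / 2) ^+ 2 / 2`!%:R : R) = 1 + x ^+ 4 / 8.
  by rewrite /= !factS fact0; field.
by rewrite -exprSr; lra.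
Qed.

Lemma cvg_monomial_pdf n : (n < 4)%N ->
  (k%:R ^+ n * phi k%:R : R) @[k --> \oo] --> (0 : R).
Proof.
move=> n4; apply: (@squeeze_cvgr _ _ _ _ (cst 0) (fun k : nat => normal_peak 1 * 8 / k%:R)).
- near=> k; rewrite mulr_ge0 ?exprn_ge0 ?normal_pdf_ge0//=.
  apply: monomial_pdf_le => //; rewrite ler1n; near: k.
  by exists 1%N.
- exact: cvg_cst.
- rewrite -[X in _ --> X](mulr0 (normal_peak (1:R) * 8)).
  apply: cvgM; first exact: cvg_cst.
  apply/cvgr0Pnorm_lt => e e0.
  near=> k; rewrite ger0_norm ?invr_ge0//.
  have : ((Num.truncn (e^-1)).+1 <= k)%N by near: k; exists (Num.truncn (e^-1)).+1.
  move=> ek; have k0 : 0 < k%:R :> R by rewrite ltr0n (leq_trans _ ek).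
  rewrite invf_plt ?posrE//; apply: (lt_le_trans (truncnS_gt _)).
  by rewrite ler_nat.
Unshelve. all: by end_near. Qed.

Definition normal_moment n := (\int[gam]_t (t ^+ n)%:E)%E.
Local Notation mom := normal_moment.

Definition centered_seg (k : nat) : set R := `[- k%:R, k%:R].
Local Notation seg := centered_seg.

Lemma cvg_normal_moment n : ~~ odd n ->
  (\int[mu]_(t in seg k) (t ^+ n * phi t)%:E)%E @[k --> \oo] --> mom n.
Proof.
move=> n2; rewrite /mom ge0_integral_normal_prob//; first last.
- by move=> t; rewrite lee_fin exprn_even_ge0.
- by apply/measurable_EFinP; exact: exprn_measurable.
have -> : setT = \bigcup_k seg k.
  apply/seteqP; split=> // t _; exists (Num.truncn `|t|).+1 => //=.
  by rewrite /seg/= in_itv/= -ler_norml ltW// truncnS_gt.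
under [X in _ --> X]eq_integral do rewrite -EFinM.
apply: ge0_nondecreasing_set_cvg_integral => //=.
- apply/nondecreasing_seqP => k; rewrite subsetEset; apply: subset_itv.
    by rewrite bnd_simp lerN2 ler_nat.
  by rewrite bnd_simp ler_nat.
- by move=> k; exact: measurable_itv.
- move=> k; apply/measurable_funTS/measurable_EFinP/measurable_funM.
    exact: exprn_measurable.
  exact: measurable_normal_pdf.
- by move=> k t _; rewrite lee_fin mulr_ge0 ?exprn_even_ge0// normal_pdf_ge0.
Qed.

Lemma continuous_monomial_pdf n : continuous (fun t : R => t ^+ n * phi t).
Proof.
by move=> x; apply: cvgM; [exact: exprn_continuous|exact: continuous_normal_pdf01].
Qed.

(** Integration by parts: the derivative of $t^{n+1}$ times the density is integrated over
    $[-k, k]$, where everything is finite, and the boundary terms vanish as $k$ grows. *)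
Lemma normal_momentSS n : (n < 3)%N -> ~~ odd n -> mom n \is a fin_num ->
  mom n.+2 = (n.+1%:R%:E * mom n)%E.
Proof.
move=> n3 n2 fn.
have cvg2 := @cvg_normal_moment n.+2; rewrite /= negbK in cvg2; have {}cvg2 := cvg2 n2.
apply: (cvg_unique _ cvg2) => //.
(* Since $n+1$ is odd and the density even, both endpoints contribute [bd k], whence the factor 2
   below. *)
pose bd k : R := k%:R ^+ n.+1 * phi k%:R.
have E : \forall k \near \oo,
    ((n.+1%:R%:E * \int[mu]_(t in seg k) (t ^+ n * phi t)%:E
      - (bd k *+ 2)%:E =
    \int[mu]_(t in seg k) (t ^+ n.+2 * phi t)%:E))%E.
  near=> k.
  have k0 : (0 : R) < k%:R by rewrite ltr0n; near: k; exists 1%N.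
  have kk : - k%:R < k%:R :> R by rewrite (lt_trans _ k0)// oppr_lt0.
  have int m : mu.-integrable (seg k) (fun t => (t ^+ m * phi t)%:E).
    apply: continuous_compact_integrable; first exact: segment_compact.
    by apply: continuous_subspaceT; exact: continuous_monomial_pdf.
  have ftc := @continuous_FTC2 R
    (fun t => n.+1%:R * (t ^+ n * phi t) - t ^+ n.+2 * phi t)
    (fun t : R => t ^+ n.+1 * phi t) _ _ kk.
  have {ftc} : (\int[mu]_(t in seg k)
     (n.+1%:R * (t ^+ n * phi t) - t ^+ n.+2 * phi t)%:E = (bd k *+ 2)%:E)%E.
    rewrite ftc.
    - rewrite -EFinB normal_pdf01N exprNn -signr_odd/= n2 expr1.
      by rewrite mulN1r mulNr opprK mulr2n.
    - apply: continuous_subspaceT => t; apply: cvgB.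
        by apply: cvgM; [exact: cvg_cst|exact: continuous_monomial_pdf].
      exact: continuous_monomial_pdf.
    - split.
      + by move=> t _; have ? := is_derive_monomial_pdf n t; exact: ex_derive.
      + apply: cvg_at_right_filter; exact: continuous_monomial_pdf.
      + apply: cvg_at_left_filter; exact: continuous_monomial_pdf.
    - move=> t _; have ? := is_derive_monomial_pdf n t.
      by rewrite derive1E; exact: derive_val.
  under eq_integral do rewrite EFinB EFinM.
  have mseg : measurable (seg k) by exact: measurable_itv.
  rewrite integralB//=; last by apply: integrableZl => //; exact: int.
  rewrite integralZl//.
  move=> /esym E; rewrite EFinN E oppeB; last first.
    by rewrite fin_num_adde_defl// fin_numN integrable_fin_num.
  by rewrite addeA subee ?add0e// fin_numM// integrable_fin_num.
apply: cvg_trans; first by apply: near_eq_cvg; exact: E.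
rewrite -[(_ * mom n)%E]sube0; apply: cvgeB => //.
- by rewrite fin_num_adde_defl// oppe0.
- by apply: cvgeZl => //; exact: cvg_normal_moment.
- apply: cvg_EFin; first by near=> k.
  rewrite -[X in _ --> X](mul0rn _ 2); apply: cvgMn.
  exact: cvg_monomial_pdf.
Unshelve. all: by end_near. Qed.

Lemma normal_moment0 : mom 0 = 1%E.
Proof.
rewrite /mom; under eq_integral do rewrite expr0.
by rewrite integral_cst//= probability_setT mul1e.
Qed.

Lemma normal_mom2 : (\int[gam]_t (t ^+ 2)%:E = 1)%E.
Proof. by rewrite -/(mom 2) normal_momentSS ?normal_moment0// mul1e. Qed.

Lemma normal_mom4 : (\int[gam]_t (t ^+ 4)%:E = 3%:E)%E.
Proof.
by rewrite -/(mom 4) normal_momentSS// normal_momentSS ?normal_moment0// ?mule1.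
Qed.

End StandardNormal.

(** * Iterated Gaussian integrals *)

Local Notation wcoord := (wkey * nat * nat)%type.

Section IteratedIntegral.
Variable R : realType.
Local Notation W := (weights R).
Local Notation gam := (normal_prob (0 : R) 1).
Implicit Types (w : W) (s : seq wcoord) (c : wcoord) (F G : W -> \bar R).

Definition plot d (X : measurableType d) (P : X -> W) : Prop :=
  forall k i j, measurable_fun setT (fun x => P x k i j).

(* Measurability on the infinite product [W], tested along all measurable     *)
(* families: this spares a sigma-algebra on [W].                              *)
Definition cmeas d (Y : measurableType d) (F : W -> Y) : Prop :=
  forall d' (X : measurableType d') (P : X -> W),
    plot P -> measurable_fun setT (F \o P).

Lemma plot_upd d (X : measurableType d) (P : X -> W) c (f : X -> R) :
  plot P -> measurable_fun setT f -> plot (fun x => upd (P x) c (f x)).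
Proof. by move=> mP mf k i j; rewrite /upd; case: eqP. Qed.

Lemma plot_cst w d (X : measurableType d) : plot (fun _ : X => w).
Proof. by move=> k i j; exact: measurable_cst. Qed.

Lemma plot_upd_cst w c : plot (fun t : R => upd w c t).
Proof. by apply: plot_upd; [exact: plot_cst|exact: measurable_id]. Qed.

Lemma gauss_iter_ge0 s F w : (forall w, 0 <= F w)%E -> (0 <= gauss_iter s F w)%E.
Proof.
by move=> F0; elim: s w => //= c s IH w; apply: integral_ge0 => t _; exact: IH.
Qed.

Lemma eq_gauss_iter s F G w : F =1 G -> gauss_iter s F w = gauss_iter s G w.
Proof. by move=> /funext ->. Qed.

Lemma cmeas_gauss_iter s F : (forall w, 0 <= F w)%E -> cmeas F ->
  cmeas (gauss_iter s F).
Proof.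
move=> F0 mF; elim: s => //= c s IH d X P mP.
pose f (z : X * R) := gauss_iter s F (upd (P z.1) c z.2).
have mf : measurable_fun setT f.
  apply: (IH _ _ (fun z : X * R => upd (P z.1) c z.2)).
  apply: plot_upd; last exact: measurable_snd.
  by move=> k i j; apply: (measurableT_comp (mP k i j)); exact: measurable_fst.
by apply: (@measurable_fun_fubini_tonelli_F _ _ _ _ _ gam f mf) => z; exact: gauss_iter_ge0.
Qed.

Lemma measurable_gauss_iter s F w c : (forall w, 0 <= F w)%E -> cmeas F ->
  measurable_fun setT (fun t : R => gauss_iter s F (upd w c t)).
Proof.
by move=> F0 mF; apply: (@cmeas_gauss_iter s F F0 mF); exact: plot_upd_cst.
Qed.

(** The integral of a nonnegative function is a supremum over the simple functions below it, so
    monotonicity needs no measurability. This serves integrands that contain [derive1]. *)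
Lemma ge0_le_integral_any (f g : R -> \bar R) :
  (forall t, 0 <= f t)%E -> (forall t, f t <= g t)%E ->
  (\int[gam]_t f t <= \int[gam]_t g t)%E.
Proof.
move=> f0 fg; have g0 t : (0 <= g t)%E by exact: le_trans (fg t).
rewrite !ge0_integralTE//; apply: le_ereal_sup => _ [h hf <-].
by exists h => // t; exact: le_trans (hf t) (fg t).
Qed.

Lemma le_gauss_iter s F G w : (forall w, 0 <= F w)%E ->
  (forall w, F w <= G w)%E -> (gauss_iter s F w <= gauss_iter s G w)%E.
Proof.
move=> F0 FG; elim: s w => //= c s IH w.
by apply: ge0_le_integral_any => t; [exact: gauss_iter_ge0|exact: IH].
Qed.

Lemma gauss_iterD s F G w : (forall w, 0 <= F w)%E -> cmeas F ->
  (forall w, 0 <= G w)%E -> cmeas G ->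
  gauss_iter s (fun w => F w + G w)%E w = (gauss_iter s F w + gauss_iter s G w)%E.
Proof.
move=> F0 mF G0 mG; elim: s w => //= c s IH w.
under eq_integral do rewrite IH.
by rewrite ge0_integralD//; solve [by move=> *; exact: gauss_iter_ge0 |
  exact: measurable_gauss_iter].
Qed.

Lemma gauss_iterZl s F w (k : \bar R) : (0 <= k)%E ->
  (forall w, 0 <= F w)%E -> cmeas F ->
  gauss_iter s (fun w => k * F w)%E w = (k * gauss_iter s F w)%E.
Proof.
move=> k0 F0 mF; elim: s w => //= c s IH w.
under eq_integral do rewrite IH.
by rewrite ge0_integralZl//; solve [by move=> *; exact: gauss_iter_ge0 |
  exact: measurable_gauss_iter].
Qed.

Lemma gauss_iter_cat s s' F w :
  gauss_iter (s ++ s') F w = gauss_iter s (gauss_iter s' F) w.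
Proof. by elim: s w => //= c s IH w; apply: eq_integral => t _; exact: IH. Qed.

Lemma updC w c c' (t t' : R) : c != c' ->
  upd (upd w c t) c' t' = upd (upd w c' t') c t.
Proof.
move=> cc'; apply/funext => k; apply/funext => i; apply/funext => j.
rewrite /upd; have [e|//] := eqVneq (k, i, j) c'.
by rewrite e eq_sym (negbTE cc').
Qed.

Lemma gauss_iter_swap c c' s F w : c != c' -> (forall w, 0 <= F w)%E -> cmeas F ->
  gauss_iter [:: c, c' & s] F w = gauss_iter [:: c', c & s] F w.
Proof.
move=> cc' F0 mF /=.
pose f (z : R * R) := gauss_iter s F (upd (upd w c z.1) c' z.2).
have mf : measurable_fun setT f.
  apply: (@cmeas_gauss_iter s F F0 mF _ _ (fun z : R * R => upd (upd w c z.1) c' z.2)).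
  apply: plot_upd; last exact: measurable_snd.
  by apply: plot_upd; [exact: plot_cst|exact: measurable_fst].
have f0 z : (0 <= f z)%E by exact: gauss_iter_ge0.
rewrite [LHS](@fubini_tonelli _ _ _ _ _ gam gam f mf f0).
by apply: eq_integral => t' _; apply: eq_integral => t _; rewrite /f/= updC.
Qed.

Lemma gauss_iter_rem c s F w : uniq s -> c \in s -> (forall w, 0 <= F w)%E ->
  cmeas F -> gauss_iter s F w = gauss_iter (c :: rem c s) F w.
Proof.
move=> + + F0 mF; elim: s w => // c' s IH w /= /andP[c's us].
rewrite in_cons eq_sym; have [-> //|cc'] := eqVneq c' c => /= cs.
rewrite -[RHS]/(gauss_iter [:: c, c' & rem c s] F w) gauss_iter_swap 1?eq_sym//.
by apply: eq_integral => t _; exact: IH.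
Qed.

Lemma perm_gauss_iter s s' F w : perm_eq s s' -> uniq s -> (forall w, 0 <= F w)%E ->
  cmeas F -> gauss_iter s F w = gauss_iter s' F w.
Proof.
move=> + + F0 mF; elim: s s' w => [|c s IH] s' w.
  by rewrite perm_sym => /perm_nilP ->.
move=> ss' /= /andP[cs us].
have cs' : c \in s' by rewrite -(perm_mem ss') mem_head.
have us' : uniq s' by rewrite -(perm_uniq ss')/= cs.
rewrite (@gauss_iter_rem c s')//=; apply: eq_integral => t _; apply: IH => //.
by rewrite -(perm_cons c) (perm_trans ss')// perm_to_rem.
Qed.

Definition depends (T : Type) (D : pred wcoord) (F : W -> T) : Prop :=
  forall w w', (forall k i j, D (k, i, j) -> w k i j = w' k i j) -> F w = F w'.

Lemma gauss_iter_depends s D F : depends D F -> depends D (gauss_iter s F).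
Proof.
move=> FD; elim: s => //= c s IH w w' ww'; apply: eq_integral => t _.
by apply: IH => k i j Dk; rewrite /upd; case: eqP => // _; exact: ww'.
Qed.

(** A coordinate that [F] ignores integrates out with total mass 1. *)
Lemma gauss_iter_filter s D F w : depends D F ->
  gauss_iter s F w = gauss_iter (seq.filter D s) F w.
Proof.
move=> FD; elim: s w => //= c s IH w; case: ifPn => [Dc|Dc] /=.
  by apply: eq_integral => t _; exact: IH.
under eq_integral => t _.
  rewrite IH (gauss_iter_depends (seq.filter D s) FD (w' := w)); last first.
    by move=> k i j Dk; rewrite /upd; case: eqP Dk Dc => // -> ->.
  over.
by rewrite integral_cst//= probability_setT mule1.
Qed.

Lemma perm_gauss_iter_depends s s' D F w : uniq s -> uniq s' ->
  {in D, s =i s'} -> depends D F -> (forall w, 0 <= F w)%E -> cmeas F ->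
  gauss_iter s F w = gauss_iter s' F w.
Proof.
move=> us us' ss' FD F0 mF.
rewrite (gauss_iter_filter _ _ FD) (gauss_iter_filter s' _ FD).
apply: perm_gauss_iter => //; last exact: filter_uniq.
apply: uniq_perm; rewrite ?filter_uniq// => c.
rewrite !mem_filter; case: (boolP (D c)) => //= Dc.
exact: ss'.
Qed.

Definition relabel (pi : wcoord -> wcoord) w : W :=
  fun k i j => let c := pi (k, i, j) in w c.1.1 c.1.2 c.2.

Lemma gauss_iter_relabel pi s F w : involutive pi ->
  gauss_iter s (F \o relabel pi) w = gauss_iter (map pi s) F (relabel pi w).
Proof.
move=> piK; elim: s w => //= c s IH w; apply: eq_integral => t _.
rewrite IH; congr (gauss_iter _ _ _).
apply/funext => k; apply/funext => i; apply/funext => j.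
rewrite /relabel /upd.
case E : (pi (k, i, j)) => [[k' i'] j'] /=.
by rewrite -(inj_eq (inv_inj piK)) -E piK.
Qed.

Definition flip (A : pred wcoord) w : W :=
  fun k i j => if A (k, i, j) then - w k i j else w k i j.

Lemma plot_flip A d (X : measurableType d) (P : X -> W) :
  plot P -> plot (fun x => flip A (P x)).
Proof.
move=> mP k i j; rewrite /flip; case: (A _) => //.
exact: measurableT_comp.
Qed.

Lemma cmeas_flip A d (Y : measurableType d) (F : W -> Y) :
  cmeas F -> cmeas (F \o flip A).
Proof. by move=> mF d' X P mP; apply: mF; exact: plot_flip. Qed.

Lemma gauss_iter_flip A s F w : (forall w, 0 <= F w)%E -> cmeas F ->
  gauss_iter s (F \o flip A) w = gauss_iter s F (flip A w).
Proof.
move=> F0 mF; elim: s w => //= c s IH w.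
transitivity (\int[gam]_t gauss_iter s F (upd (flip A w) c (if A c then - t else t : R)%R))%E.
  apply: eq_integral => t _; rewrite IH; congr (gauss_iter _ _ _).
  apply/funext => k; apply/funext => i; apply/funext => j.
  by rewrite /flip /upd; case: eqP => // ->.
case: (A c) => //.
rewrite (@ge0_integral_normalN _ (fun t => gauss_iter s F (upd (flip A w) c t)))//.
  exact: measurable_gauss_iter.
by move=> t; exact: gauss_iter_ge0.
Qed.

Lemma gaussE_flip A s F : (forall w, 0 <= F w)%E -> cmeas F ->
  gaussE s (F \o flip A) = gaussE s F.
Proof.
move=> F0 mF; rewrite /gaussE gauss_iter_flip//; congr gauss_iter.
by apply/funext => k; apply/funext => i; apply/funext => j; rewrite /flip oppr0 if_same.
Qed.

Lemma cmeas_if d (Y : measurableType d) (b : W -> bool) (F1 F2 : W -> Y) :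
  cmeas b -> cmeas F1 -> cmeas F2 -> cmeas (fun w => if b w then F1 w else F2 w).
Proof.
move=> mb m1 m2 d' X P mP; apply: (@measurable_fun_ifT _ _ _ _ (F1 \o P) (F2 \o P)).
- exact: mb.
- exact: m1.
- exact: m2.
Qed.

Lemma cmeas_cst d (Y : measurableType d) (y : Y) : cmeas (fun _ => y).
Proof. by move=> d' X P _; exact: measurable_cst. Qed.

(* The set [sg = true] is invariant under the sign change [flip A], so        *)
(* changing signs on this set only preserves the law of the weights.         *)
Lemma gaussE_cond_flip A (sg : W -> bool) s F :
  (forall w, 0 <= F w)%E -> cmeas F -> cmeas sg -> (forall w, sg (flip A w) = sg w) ->
  gaussE s (fun w => F (if sg w then flip A w else w)) = gaussE s F.
Proof.
move=> F0 mF msg sgA.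
pose F1 w := if sg w then F w else 0%E.
pose F2 w := if sg w then 0%E else F w.
have F10 w : (0 <= F1 w)%E by rewrite /F1; case: ifP.
have F20 w : (0 <= F2 w)%E by rewrite /F2; case: ifP.
have m1 : cmeas F1 by apply: cmeas_if => //; exact: cmeas_cst.
have m2 : cmeas F2 by apply: cmeas_if => //; exact: cmeas_cst.
transitivity (gaussE s (fun w => (F1 \o flip A) w + F2 w)%E).
  apply: eq_gauss_iter => w; rewrite /F1 /F2 /= sgA.
  by case: ifP; rewrite ?adde0 ?add0e.
have m1A : cmeas (F1 \o flip A) by exact: cmeas_flip.
have F10A w : (0 <= (F1 \o flip A) w)%E by exact: F10.
rewrite /gaussE gauss_iterD//.
rewrite -/(gaussE s _) gaussE_flip// /gaussE -gauss_iterD//.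
by apply: eq_gauss_iter => w; rewrite /F1 /F2; case: ifP; rewrite ?adde0 ?add0e.
Qed.

Definition null s (N : W -> bool) : Prop :=
  cmeas N /\ forall w, gauss_iter s (fun w => (N w)%:R%:E) w = 0%E.

Lemma cmeas_comp d d' (Y : measurableType d) (Z : measurableType d') (f : Y -> Z)
  (F : W -> Y) : measurable_fun setT f -> cmeas F -> cmeas (f \o F).
Proof.
by move=> mf mF d'' X P mP; apply: (measurableT_comp mf); exact: mF.
Qed.

Lemma cmeas_indic (N : W -> bool) : cmeas N -> cmeas (fun w => (N w)%:R%:E : \bar R).
Proof. by move=> mN; apply: (cmeas_comp (f := fun b : bool => (b%:R : R)%:E)). Qed.

Lemma null_or s N N' : null s N -> null s N' -> null s (fun w => N w || N' w).
Proof.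
move=> [mN N0] [mN' N0']; split.
  by move=> d X P mP; apply: measurable_or; [exact: mN|exact: mN'].
move=> w; apply/eqP; rewrite eq_le gauss_iter_ge0 ?andbT; last first.
  by move=> ?; rewrite lee_fin.
apply: (@le_trans _ _ (gauss_iter s (fun w => (N w)%:R%:E + (N' w)%:R%:E)%E w)).
  apply: le_gauss_iter => {}w; first by rewrite lee_fin.
  by rewrite -EFinD lee_fin -natrD ler_nat; case: (N w); case: (N' w).
rewrite gauss_iterD ?N0 ?N0' ?adde0//; solve [exact: cmeas_indic|by move=> ?; rewrite lee_fin].
Qed.

Lemma gauss_iter0 s w : gauss_iter s (fun _ => 0%E : \bar R) w = 0%E.
Proof.
elim: s w => //= c s IH w; under eq_integral do rewrite IH.
by rewrite integral0.
Qed.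

Lemma null_false s : null s (fun _ => false).
Proof. by split; [exact: cmeas_cst|move=> w; exact: gauss_iter0]. Qed.

Lemma null_has (T : Type) (r : seq T) s (N : T -> W -> bool) :
  (forall x, null s (N x)) -> null s (fun w => has (N^~ w) r).
Proof.
by move=> hN; elim: r => [|x r IH] /=; [exact: null_false|exact: null_or].
Qed.

(** With [c] moved to the innermost integral, each slice of [N] has at most one point, and the
    normal law has no atoms. *)
Lemma null_slice s c (N : W -> bool) : uniq s -> c \in s -> cmeas N ->
  (forall w t t', N (upd w c t) -> N (upd w c t') -> t = t') -> null s N.
Proof.
move=> us cs mN inj; split=> // w.
have N0 w' : (0 <= (N w')%:R%:E :> \bar R)%E by rewrite lee_fin.
have mN' := cmeas_indic mN.
rewrite (@perm_gauss_iter s (rem c s ++ [:: c]))//; last first.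
  by rewrite (perm_trans (perm_to_rem cs))// -cat1s perm_catC.
rewrite gauss_iter_cat -[RHS](gauss_iter0 (rem c s) w).
apply: eq_gauss_iter => {}w /=.
have [[a Na]|nN] := pselect (exists t, N (upd w c t)); last first.
  rewrite integral0_eq// => t _.
  by case: (boolP (N _)) => // Nt; exfalso; apply: nN; exists t.
apply/eqP; rewrite eq_le integral_ge0// andbT.
have <- : (\int[gam]_t (\1_[set a] t)%:E = 0)%E.
  by rewrite integral_indic// setIT; exact: normal_prob_set1.
apply: ge0_le_integral_any => // t; rewrite lee_fin ler_nat.
case: (boolP (N _)) => // Nt; rewrite (inj _ _ _ Nt Na).
by rewrite mem_set.
Qed.

(** [F] may fail to be measurable, so it cannot be split additively. Instead it is squeezed between
    [G] cut off on [N] and the same function plus infinity times the indicator of [N]; the two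
    integrals agree because $\infty \cdot 0 = 0$. *)
Lemma eq_gaussE_null s N F G : null s N ->
  (forall w, 0 <= F w)%E -> (forall w, 0 <= G w)%E -> cmeas G ->
  (forall w, ~~ N w -> F w = G w) -> gaussE s F = gaussE s G.
Proof.
move=> [mN N0] F0 G0 mG FG.
pose G' w := if N w then 0%E else G w.
have G'0 w : (0 <= G' w)%E by rewrite /G'; case: ifP.
have mG' : cmeas G' by apply: cmeas_if => //; exact: cmeas_cst.
suff E H : (forall w, 0 <= H w)%E -> (forall w, ~~ N w -> H w = G w) ->
    gaussE s H = gaussE s G' by rewrite E// [RHS]E.
move=> H0 HG; apply/eqP; rewrite eq_le; apply/andP; split.
  apply: (@le_trans _ _ (gaussE s (fun w => G' w + +oo * (N w)%:R%:E)%E)).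
    apply: le_gauss_iter => // w; rewrite /G'; case: (boolP (N w)) => Nw.
      by rewrite add0e mule1 leey.
    by rewrite mule0 adde0 HG.
  have mN' := cmeas_indic mN.
  have I0 w : (0 <= (N w)%:R%:E :> \bar R)%E by rewrite lee_fin.
  have yI0 w : (0 <= +oo * ((N w)%:R%:E : \bar R))%E by rewrite mule_ge0.
  have myI : cmeas (fun w => +oo * ((N w)%:R%:E : \bar R))%E.
    by move=> d X P mP; apply: emeasurable_funM => //; exact: mN'.
  by rewrite /gaussE gauss_iterD// gauss_iterZl// N0 mule0 adde0.
apply: le_gauss_iter => // w; rewrite /G'; case: (boolP (N w)) => // Nw.
by rewrite HG.
Qed.

End IteratedIntegral.

(** * Moments of Gaussian linear forms *)

Section LinearForms.
Variable R : realType.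
Local Notation W := (weights R).
Local Notation gam := (normal_prob (0 : R) 1).
Implicit Types (w : W) (s : seq wcoord) (c : wcoord) (F G : W -> \bar R).

(** By symmetry of the law only the even part of [f] counts, so the odd terms of an expanded power,
    which have no sign, are never integrated. *)
Lemma integral_normal_even_part (f : R -> R) (A B C : R) :
  measurable_fun setT f -> (forall t, 0 <= f t) ->
  0 <= A -> 0 <= B -> 0 <= C ->
  (forall t, f t + f (- t) = 2 * (A + B * t ^+ 2 + C * t ^+ 4)) ->
  (\int[gam]_t (f t)%:E = (A + B + 3 * C)%:E)%E.
Proof.
move=> mf f0 A0 B0 C0 fE.
pose g t : \bar R := (f t / 2)%:E.
have g0 t : (0 <= g t)%E by rewrite lee_fin divr_ge0.
have mg : measurable_fun setT g.
  by apply/measurable_EFinP; exact: measurable_funM.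
have mgN : measurable_fun setT (fun t : R => g (- t)) by exact: measurableT_comp.
have t20 (t : R) : (0 <= (t ^+ 2)%:E)%E by rewrite lee_fin sqr_ge0.
have t40 (t : R) : (0 <= (t ^+ 4)%:E)%E by rewrite lee_fin exprn_even_ge0.
have mX n : measurable_fun setT (fun t : R => (t ^+ n)%:E).
  by apply/measurable_EFinP; exact: exprn_measurable.
have mZ (k : R) n : measurable_fun setT (fun t : R => (k%:E * (t ^+ n)%:E)%E).
  by apply: emeasurable_funM; [exact: measurable_cst|exact: mX].
transitivity (\int[gam]_t (g t + g t))%E.
  by apply: eq_integral => t _; rewrite -EFinD -splitr.
rewrite ge0_integralD//.
rewrite -[X in (_ + X)%E](ge0_integral_normalN mg)// -ge0_integralD//.
transitivity (\int[gam]_t (A%:E + (B%:E * (t ^+ 2)%:E + C%:E * (t ^+ 4)%:E)))%E.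
  apply: eq_integral => t _; rewrite -!EFinM -!EFinD -mulrDl fE; congr (_%:E).
  by field.
rewrite ge0_integralD//; first last.
- by apply: emeasurable_funD; exact: mZ.
- by move=> t _; rewrite adde_ge0// mule_ge0// lee_fin.
have Z0 (k t : R) n : 0 <= k -> ~~ odd n -> (0 <= k%:E * (t ^+ n)%:E)%E.
  by move=> k0 n2; rewrite mule_ge0// lee_fin exprn_even_ge0.
have -> := @ge0_integralD _ _ _ gam _ measurableT _ _
  (fun t _ => Z0 B t 2%N B0 isT) (mZ B 2%N) (fun t _ => Z0 C t 4%N C0 isT) (mZ C 4%N).
rewrite !ge0_integralZl ?lee_fin//; do ?exact: mX.
rewrite [X in (B%:E * X + _)%E]normal_mom2 [X in (C%:E * X)%E]normal_mom4.
rewrite integral_cst//= probability_setT !mule1 -EFinM -!EFinD addrA.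
by rewrite [C * 3]mulrC.
Qed.

Definition weight_at w c : R := w c.1.1 c.1.2 c.2.

Lemma weight_at_upd w c c' t :
  weight_at (upd w c t) c' = if c' == c then t else weight_at w c'.
Proof. by case: c' => -[k i] j. Qed.

(** Only the coordinates in [s] vary during the iterated integral; all others keep their value in
    [w]. *)
Lemma eq_gauss_iter_off s F G w :
  (forall w', (forall c, c \notin s -> weight_at w' c = weight_at w c) -> F w' = G w') ->
  gauss_iter s F w = gauss_iter s G w.
Proof.
elim: s w => [|c s IH] w FG /=; first by apply: FG.
apply: eq_integral => t _; apply: IH => w' w'E; apply: FG => c'.
rewrite in_cons negb_or => /andP[c'c c's].
by rewrite w'E// weight_at_upd (negbTE c'c).
Qed.

(** The constant [a] absorbs the coordinates already fixed by outer integrals, which lets the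
    induction on [s] go through. *)
Lemma gauss_iter_linear_sqr s (b : wcoord -> R) (a : R) w : uniq s ->
  gauss_iter s (fun w' => ((a + \sum_(c <- s) b c * weight_at w' c) ^+ 2)%:E) w =
  (a ^+ 2 + \sum_(c <- s) b c ^+ 2)%:E.
Proof.
elim: s a w => [|c s IH] a w; first by rewrite /= !big_nil !addr0.
move=> /= /andP[cs us].
transitivity (\int[gam]_t ((a + b c * t) ^+ 2 + \sum_(c <- s) b c ^+ 2)%:E)%E.
  apply: eq_integral => t _; rewrite -(IH _ (upd w c t))//.
  apply: eq_gauss_iter_off => w' w'E.
  by rewrite big_cons addrA w'E// weight_at_upd eqxx.
set S := \sum_(c <- s) _.
have S0 : 0 <= S by apply: sumr_ge0 => *; exact: sqr_ge0.
rewrite (@integral_normal_even_part _ (a ^+ 2 + S) (b c ^+ 2) 0)//.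
- by rewrite big_cons -/S; congr (_%:E); ring.
- apply: measurable_funD => //; apply: measurable_funX.
  by apply: measurable_funD => //; exact: measurable_funM.
- by move=> t; rewrite addr_ge0// sqr_ge0.
- by rewrite addr_ge0// sqr_ge0.
- exact: sqr_ge0.
- by move=> t; ring.
Qed.

(** This is the fourth moment of a normal variable of mean [a] and variance [S]; at $a = 0$ its
    factor 3 is the constant of the theorem. *)
Lemma gauss_iter_linear_exp4 s (b : wcoord -> R) (a : R) w : uniq s ->
  let S := \sum_(c <- s) b c ^+ 2 in
  gauss_iter s (fun w' => ((a + \sum_(c <- s) b c * weight_at w' c) ^+ 4)%:E) w =
  (a ^+ 4 + 6 * a ^+ 2 * S + 3 * S ^+ 2)%:E.
Proof.
elim: s a w => [|c s IH] a w.
  by move=> _ /=; rewrite !big_nil !addr0; congr (_%:E); ring.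
move=> /= /andP[cs us].
transitivity (\int[gam]_t ((a + b c * t) ^+ 4
  + 6 * (a + b c * t) ^+ 2 * (\sum_(c <- s) b c ^+ 2)
  + 3 * (\sum_(c <- s) b c ^+ 2) ^+ 2)%:E)%E.
  apply: eq_integral => t _; rewrite -(IH _ (upd w c t))//.
  apply: eq_gauss_iter_off => w' w'E.
  by rewrite big_cons addrA w'E// weight_at_upd eqxx.
rewrite big_cons; set S := \sum_(c <- s) _.
have S0 : 0 <= S by apply: sumr_ge0 => *; exact: sqr_ge0.
rewrite (@integral_normal_even_part _
  (a ^+ 4 + 6 * a ^+ 2 * S + 3 * S ^+ 2) (6 * a ^+ 2 * b c ^+ 2 + 6 * b c ^+ 2 * S)
  (b c ^+ 4))//.
- by congr (_%:E); ring.
- have m1 : measurable_fun setT (fun t : R => a + b c * t).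
    by apply: measurable_funD => //; exact: measurable_funM.
  apply: measurable_funD => //; apply: measurable_funD; first exact: measurable_funX.
  apply: measurable_funM => //; apply: measurable_funM => //.
  exact: measurable_funX.
- by move=> t; do ![by rewrite exprn_even_ge0|exact: ler0n|exact: S0|apply: addr_ge0|apply: mulr_ge0].
- by do ![by rewrite exprn_even_ge0|exact: ler0n|exact: S0|apply: addr_ge0|apply: mulr_ge0].
- by do ![by rewrite exprn_even_ge0|exact: ler0n|exact: S0|apply: addr_ge0|apply: mulr_ge0].
- by rewrite exprn_even_ge0.
- by move=> t; ring.
Qed.

End LinearForms.

(** * Layered networks *)

Section CourseOfValues.
Variables (T : Type) (t0 : T) (step : nat -> (nat -> T) -> T).

(** Table of the values below [n]. It lets a layer read all earlier layers, as skip and dense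
    connections require; [covE] recovers the recursion equation for a [step] that looks only
    below. *)
Fixpoint hist n : nat -> T :=
  if n is n'.+1 then fun h => if h == n' then step n' (hist n') else hist n' h
  else fun _ => t0.

Definition cov n := step n (hist n).

Lemma histE n h : (h < n)%N -> hist n h = cov h.
Proof.
elim: n => //= n IH; rewrite ltnS leq_eqVlt; have [-> //|hn /= hlt] := eqVneq.
exact: IH.
Qed.

Lemma covE n : (forall a a', (forall h, (h < n)%N -> a h = a' h) -> step n a = step n a') ->
  cov n = step n cov.
Proof. by move=> loc; apply: loc => h /histE. Qed.

End CourseOfValues.

(* Layer [m] reads the layers [h < m] through matrices [key m h] (when        *)
(* [edge m h]) and through scalar skip connections [sk m h]; layer [0] is the *)
(* input, and a layer is read through its activation: ReLU when [rl] holds,   *)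
(* the identity otherwise.                                                    *)
Record net (R : realType) := Net {
  dim : nat -> nat;
  rl : nat -> bool;
  edge : nat -> nat -> bool;
  key : nat -> nat -> wkey;
  cf : nat -> nat -> R;
  sk : nat -> nat -> R }.

Section Network.
Variables (R : realType) (N : net R) (x : vec R).
Local Notation W := (weights R).
Local Notation dim := (dim N).
Local Notation rl := (rl N).
Local Notation edge := (edge N).
Local Notation key := (key N).
Local Notation cf := (cf N).
Local Notation sk := (sk N).
Implicit Types (w : W) (m h i j : nat) (keep : pred nat) (a p : nat -> vec R).

(** [keep] selects the layers that are read: [predT] in the full network, [leq m0] once the bypasses
    of layer [m0] are removed. *)
Definition sumin w m keep a : vec R := fun i =>
  \sum_(h < m | keep h) sk m h * a h i +
  \sum_(h < m | keep h && edge m h)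
     cf m h * \sum_(j < dim h) w (key m h) i j * a h j.

Lemma eq_sumin w w' m keep a a' i :
  (forall h, (h < m)%N -> keep h -> sk m h != 0 -> a h i = a' h i) ->
  (forall h j, (h < m)%N -> keep h -> edge m h -> (j < dim h)%N ->
     w (key m h) i j * a h j = w' (key m h) i j * a' h j) ->
  sumin w m keep a i = sumin w' m keep a' i.
Proof.
move=> Hsk Hed; congr (_ + _); apply: eq_bigr => h.
  by move=> kh; have [->|sk0] := eqVneq (sk m h) 0; rewrite ?mul0r ?Hsk.
by move=> /andP[kh eh]; congr (_ * _); apply: eq_bigr => j _; exact: Hed.
Qed.

Lemma sumin_keep w m keep p i :
  (forall h i, (h < m)%N -> ~~ keep h -> p h i = 0) ->
  sumin w m predT p i = sumin w m keep p i.
Proof.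
move=> p0; rewrite /sumin; congr (_ + _).
  rewrite [RHS]big_mkcond; apply: eq_bigr => h _; case: ifPn => // kh.
  by rewrite p0// mulr0.
rewrite [RHS]big_mkcond [LHS]big_mkcond; apply: eq_bigr => h _ /=.
case: ifPn => [eh|]; last by rewrite andbF.
rewrite andbT; case: ifPn => // kh; rewrite big1 ?mulr0// => j _.
by rewrite p0// mulr0.
Qed.

Lemma suminN w w' m keep a i :
  (forall h, (h < m)%N -> sk m h = 0) ->
  (forall h j, (h < m)%N -> keep h -> edge m h -> w' (key m h) i j = - w (key m h) i j) ->
  sumin w' m keep a i = - sumin w m keep a i.
Proof.
move=> sk0 wN; rewrite /sumin.
have -> : \sum_(h < m | keep h) sk m h * a h i = 0.
  by rewrite big1// => h _; rewrite sk0// mul0r.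
rewrite !add0r -sumrN; apply: eq_bigr => h /andP[kh eh].
rewrite -mulrN -sumrN; congr (_ * _); apply: eq_bigr => j _.
by rewrite wN// mulNr.
Qed.

Lemma sumin_lin (I : finType) w m keep (g : I -> R) (P : I -> nat -> vec R) i :
  sumin w m keep (fun h j => \sum_q g q * P q h j) i =
  \sum_q g q * sumin w m keep (P q) i.
Proof.
under [RHS]eq_bigr do rewrite /sumin mulrDr.
rewrite big_split; congr (_ + _).
  under [RHS]eq_bigr do rewrite mulr_sumr.
  rewrite exchange_big; apply: eq_bigr => h _; rewrite mulr_sumr.
  by apply: eq_bigr => q _; rewrite mulrCA.
under [RHS]eq_bigr do rewrite mulr_sumr.
rewrite exchange_big; apply: eq_bigr => h _.
under [RHS]eq_bigr do rewrite mulrCA.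
rewrite -mulr_sumr; congr (_ * _).
under [RHS]eq_bigr do rewrite mulr_sumr.
rewrite exchange_big; apply: eq_bigr => j _; rewrite mulr_sumr.
by apply: eq_bigr => q _; rewrite mulrCA.
Qed.

Lemma sumin_affine w m keep a p (e : R) i :
  sumin w m keep (fun h j => a h j + e * p h j) i =
  sumin w m keep a i + e * sumin w m keep p i.
Proof.
have /= := @sumin_lin bool w m keep (fun b => if b then 1 else e)
  (fun b => if b then a else p) i.
rewrite big_bool mul1r => <-; apply: eq_sumin => [h _ _ _|h j _ _ _ _];
  by rewrite big_bool mul1r.
Qed.

Lemma sumin_upd w m h a i r b (t : R) : (h < m)%N -> edge m h -> (b < dim h)%N ->
  (forall h', (h' < m)%N -> edge m h' -> key m h' = key m h -> h' = h) ->
  sumin (upd w (key m h, r, b) t) m predT a i =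
  sumin w m predT a i
  + (if i == r then (t - w (key m h) r b) * (cf m h * a h b) else 0).
Proof.
move=> hm eh bh inj; rewrite /sumin -addrA; congr (_ + _).
rewrite (bigD1 (Ordinal hm))//= [in RHS](bigD1 (Ordinal hm))//= addrAC.
congr (_ + _); last first.
  apply: eq_bigr => h' /andP[eh' h'h]; congr (_ * _); apply: eq_bigr => j _.
  rewrite /upd; case: eqP => // -[kk _ _]; case/eqP: h'h; apply: val_inj.
  rewrite /=; exact: inj kk.
rewrite (bigD1 (Ordinal bh))//= [in RHS](bigD1 (Ordinal bh))//= /upd.
have -> : ((key m h, i, b) == (key m h, r, b)) = (i == r).
  by apply/eqP/eqP => [[]|->].
set S := \sum_(j < _ | _) _; set S' := \sum_(j < _ | _) _.
have -> : S = S'.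
  apply: eq_bigr => j jb; case: eqP => // -[_ jE]; case/eqP: jb.
  exact: val_inj.
by case: eqP => [->|_]; ring.
Qed.

(** Gate and value are separate arguments: for a frozen gate the map is linear in [y], like the
    derivative of the activation, and for [g = y] it is the activation itself. *)
Definition actd (r : bool) (g y : R) : R :=
  if r then Num.sqrt 2 * ((0 < g)%R%:R * y) else y.

Lemma actd_relu (y : R) : actd true y y = Num.sqrt 2 * relu y.
Proof.
by rewrite /actd /relu; case: ltP => _; rewrite ?mul1r ?mul0r.
Qed.

Lemma actd_lin (I : finType) r g (c : I -> R) (y : I -> R) :
  actd r g (\sum_q c q * y q) = \sum_q c q * actd r g (y q).
Proof.
case: r => //=; rewrite !mulr_sumr; apply: eq_bigr => q _.
by ring.
Qed.

Lemma actd0 r g : actd r g 0 = 0.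
Proof. by case: r => //=; rewrite !mulr0. Qed.

End Network.

(* [pre] and [tang] are locked because failing conversion tests between two   *)
(* unfolded recursions explode.                                               *)
HB.lock Definition pre (R : realType) (N : net R) (x : vec R) (w : weights R) :
    nat -> vec R :=
  cov (fun _ => 0) (fun m z => if m is 0%N then x
    else sumin N w m predT (fun h i => actd (rl N h) (z h i) (z h i))).
Arguments pre {R} N x w.

Section Forward.
Variables (R : realType) (N : net R) (x : vec R).
Local Notation W := (weights R).
Local Notation dim := (dim N).
Local Notation rl := (rl N).
Local Notation edge := (edge N).
Local Notation key := (key N).
Local Notation sumin := (sumin N).
Local Notation pre := (pre N x).
Implicit Types (w : W) (m h i j : nat).

Definition post w h : vec R := fun i => actd (rl h) (pre w h i) (pre w h i).

Lemma pre0 w : pre w 0%N = x. Proof. by rewrite unlock. Qed.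

Lemma preE w m : (0 < m)%N -> pre w m = sumin w m predT (post w).
Proof.
move=> m0; rewrite /post unlock covE; first by case: m m0.
case: m m0 => // m _ a a' aa'; apply/funext => i.
by apply: eq_sumin => [h hm _ _|h j hm _ _ _]; rewrite aa'.
Qed.

Lemma pre_unique w (M : nat) (z : nat -> vec R) : z 0%N = x ->
  (forall m, (0 < m <= M)%N ->
     z m = sumin w m predT (fun h i => actd (rl h) (z h i) (z h i))) ->
  forall m, (m <= M)%N -> z m = pre w m.
Proof.
move=> z0 zS; elim/ltn_ind => -[|m] IH mM; first by rewrite pre0.
rewrite zS// preE//.
apply/funext => i; apply: eq_sumin => [h hm _ _|h j hm _ _ _];
  by rewrite /post IH// (leq_trans (ltnW hm)).
Qed.

Lemma pre_local w w' m :
  (forall m' h, (h < m' <= m)%N -> edge m' h -> w (key m' h) = w' (key m' h)) ->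
  pre w m = pre w' m.
Proof.
elim/ltn_ind: m => -[|m] IH loc; first by rewrite !pre0.
rewrite !preE//; apply/funext => i.
have post_eq h : (h < m.+1)%N -> post w h = post w' h.
  move=> hm; rewrite /post IH// => m' h' /andP[h'm' m'h] e.
  by apply: loc => //; rewrite h'm' (leq_trans m'h)// ltnW.
apply: eq_sumin => [h hm _ _|h j hm _ e _]; rewrite post_eq//.
by rewrite loc// hm leqnn.
Qed.

End Forward.

(* Propagation of a perturbation [G] of the matrix [key m0 h0]. A unit is     *)
(* gated by the network itself where [B] is false (so that [B = false] gives  *)
(* the derivative), and by the propagated value where [B] is true (so that    *)
(* [B = true] gives the reduced network, with [G] for the matrix).            *)
HB.lock Definition tang (R : realType) (N : net R) (x : vec R) (m0 h0 : nat)
    (B : nat -> nat -> bool) (w : weights R) (G : nat -> nat -> R) : nat -> vec R :=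
  cov (fun _ => 0) (fun m v =>
    if (m < m0)%N then (fun _ => 0)
    else if m == m0 then
      (fun i => cf N m0 h0 * \sum_(j < dim N h0) G i j * post N x w h0 j)
    else sumin N w m (leq m0)
      (fun h i => actd (rl N h) (if B h i then v h i else pre N x w h i) (v h i))).
Arguments tang {R} N x m0 h0 B w G.

Section Tangent.
Variables (R : realType) (N : net R) (x : vec R) (m0 h0 : nat).
Local Notation W := (weights R).
Local Notation dim := (dim N).
Local Notation rl := (rl N).
Local Notation edge := (edge N).
Local Notation key := (key N).
Local Notation cf := (cf N).
Local Notation sk := (sk N).
Local Notation sumin := (sumin N).
Local Notation pre := (pre N x).
Local Notation post := (post N x).
Local Notation tang := (tang N x m0 h0).
Implicit Types (w : W) (m h i j : nat) (B : nat -> nat -> bool) (G : nat -> nat -> R).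

Definition ptang B w G h : vec R := fun i =>
  actd (rl h) (if B h i then tang B w G h i else pre w h i) (tang B w G h i).

Lemma tang_lt B w G m : (m < m0)%N -> tang B w G m = (fun _ => 0).
Proof. by rewrite unlock /cov => ->. Qed.

Lemma tang_eq B w G :
  tang B w G m0 = fun i => cf m0 h0 * \sum_(j < dim h0) G i j * post w h0 j.
Proof. by rewrite unlock /cov ltnn eqxx. Qed.

Lemma tang_gt B w G m : (m0 < m)%N -> tang B w G m = sumin w m (leq m0) (ptang B w G).
Proof.
move=> mm; have mF : (m < m0)%N = false by rewrite ltnNge ltnW.
rewrite /ptang unlock covE mF gtn_eqF// => a a' aa'; apply/funext => i.
by apply: eq_sumin => [h hm _ _|h j hm _ _ _]; rewrite aa'.
Qed.

Lemma ptang_lt B w G h i : (h < m0)%N -> ptang B w G h i = 0.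
Proof. by move=> hm; rewrite /ptang tang_lt// actd0. Qed.

Lemma tang_unique B w G (M : nat) (z : nat -> vec R) :
  (forall i, z m0 i = cf m0 h0 * \sum_(j < dim h0) G i j * post w h0 j) ->
  (forall m, (m0 < m <= M)%N -> z m = sumin w m (leq m0)
     (fun h i => actd (rl h) (if B h i then z h i else pre w h i) (z h i))) ->
  forall m, (m0 <= m <= M)%N -> z m = tang B w G m.
Proof.
move=> z0 zS; elim/ltn_ind => m IH /andP[mm mM]; apply/funext => i.
move: mm; rewrite leq_eqVlt => /predU1P[<-|mm]; first by rewrite tang_eq.
rewrite zS ?mm// tang_gt//.
apply: eq_sumin => [h hm kh _|h j hm kh _ _];
  by rewrite /ptang IH// (leq_trans (ltnW hm))// andbT.
Qed.

Variable M : nat.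
Hypothesis dim_sk : forall m h, (h < m <= M)%N -> sk m h != 0 -> dim m = dim h.

(** Records all that the propagation reads: [post] at [h0], the direction [G], the pre-activations
    at ReLU units not yet exchanged, and the matrices into layers above [m0] from layers not below
    [m0]. Most later independence claims are instances of this. *)
Lemma tang_local B B' w w' G G' m i : (m <= M)%N -> (i < dim m)%N ->
  post w h0 = post w' h0 ->
  (forall h i, (m0 <= h < m)%N -> (i < dim h)%N -> rl h -> B h i = B' h i) ->
  (forall h i, (m0 <= h < m)%N -> (i < dim h)%N -> rl h -> ~~ B h i ->
     pre w h i = pre w' h i) ->
  (forall r b, (r < dim m0)%N -> (b < dim h0)%N -> G r b = G' r b) ->
  (forall m' h, (m0 < m' <= m)%N -> (m0 <= h < m')%N -> edge m' h ->
     w (key m' h) = w' (key m' h)) ->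
  tang B w G m i = tang B' w' G' m i.
Proof.
elim/ltn_ind: m i => m IH i mM im E0 EB Epre EG Ew.
have [mm|mm|mm] := ltngtP m m0.
- by rewrite !tang_lt.
- rewrite tang_gt// tang_gt//.
  have ptE h j : (h < m)%N -> (m0 <= h)%N -> (j < dim h)%N ->
      ptang B w G h j = ptang B' w' G' h j.
    move=> hm mh jh.
    have tE : tang B w G h j = tang B' w' G' h j.
      apply: IH => //.
      - exact: leq_trans (ltnW hm) mM.
      - by move=> h' i' /andP[? h'h]; apply: EB; rewrite (ltn_trans h'h) ?andbT.
      - by move=> h' i' /andP[? h'h]; apply: Epre; rewrite (ltn_trans h'h) ?andbT.
      - move=> m' h' /andP[? m'h]; apply: Ew.
        by rewrite (leq_trans m'h (ltnW hm)) andbT.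
    rewrite /ptang tE; case: (boolP (rl h)) => // rh; congr actd.
    rewrite -EB ?mh//; case: (boolP (B h j)) => // nB.
    by rewrite Epre ?mh.
  apply: eq_sumin => [h hm mh sk0|h j hm mh e jh]; last first.
    by rewrite ptE// Ew ?mm ?leqnn ?mh.
  by apply: ptE => //; rewrite -(@dim_sk m)// hm.
- subst m; rewrite !tang_eq; congr (_ * _); apply: eq_bigr => j _.
  by rewrite E0 EG.
Qed.

End Tangent.

(** * Measurability of the network and of its propagated values *)

Section MeasurableNetwork.
Variables (R : realType) (N : net R) (x : vec R).
Local Notation W := (weights R).

Lemma cmeas_at k i j : cmeas (fun w : W => w k i j).
Proof. by move=> d X P mP; exact: mP. Qed.

Lemma cmeasD (f g : W -> R) : cmeas f -> cmeas g -> cmeas (fun w => f w + g w).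
Proof.
by move=> mf mg d X P mP; apply: measurable_funD; [exact: mf|exact: mg].
Qed.

Lemma cmeasM (f g : W -> R) : cmeas f -> cmeas g -> cmeas (fun w => f w * g w).
Proof.
by move=> mf mg d X P mP; apply: measurable_funM; [exact: mf|exact: mg].
Qed.

Lemma cmeas_sum (I : Type) (r : seq I) (p : pred I) (f : I -> W -> R) :
  (forall q, cmeas (f q)) -> cmeas (fun w => \sum_(q <- r | p q) f q w).
Proof.
move=> mf; elim: r => [|q r IH].
  by under [X in cmeas X]eq_fun do rewrite big_nil; exact: cmeas_cst.
under [X in cmeas X]eq_fun do rewrite big_cons.
by case: (p q) => //; exact: cmeasD.
Qed.

Lemma cmeas_lt (f g : W -> R) : cmeas f -> cmeas g -> cmeas (fun w => f w < g w).
Proof.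
by move=> mf mg d X P mP; apply: measurable_fun_ltr; [exact: mf|exact: mg].
Qed.

Lemma cmeas_eq0 (f : W -> R) : cmeas f -> cmeas (fun w => f w == 0).
Proof.
move=> mf d X P mP; apply: (@measurable_fun_eqr _ _ _ _ (f \o P) (cst 0)) => //.
exact: mf.
Qed.

Lemma cmeas_and (f g : W -> bool) : cmeas f -> cmeas g -> cmeas (fun w => f w && g w).
Proof.
by move=> mf mg d X P mP; apply: measurable_and; [exact: mf|exact: mg].
Qed.

Lemma cmeas_neg (f : W -> bool) : cmeas f -> cmeas (fun w => ~~ f w).
Proof. by move=> mf d X P mP; apply: measurable_neg; exact: mf. Qed.

Lemma cmeas_sumin (a : W -> nat -> vec R) m keep i :
  (forall h j, (h < m)%N -> cmeas (fun w => a w h j)) ->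
  cmeas (fun w => sumin N w m keep (a w) i).
Proof.
move=> ma; apply: cmeasD; apply: cmeas_sum => h.
  by apply: cmeasM; [exact: cmeas_cst|exact: ma].
apply: cmeasM; first exact: cmeas_cst.
apply: cmeas_sum => j.
by apply: cmeasM; [exact: cmeas_at|exact: ma].
Qed.

Lemma cmeas_actd r (g y : W -> R) : cmeas g -> cmeas y ->
  cmeas (fun w => actd r (g w) (y w)).
Proof.
move=> mg my; case: r => //=; apply: cmeasM; first exact: cmeas_cst.
apply: cmeasM => //.
apply: (cmeas_comp (f := fun b : bool => b%:R : R)) => //.
by apply: cmeas_lt => //; exact: cmeas_cst.
Qed.

Lemma cmeas_pre m i : cmeas (fun w => pre N x w m i).
Proof.
elim/ltn_ind: m i => -[|m] IH i.
  by under [X in cmeas X]eq_fun do rewrite pre0; exact: cmeas_cst.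
under [X in cmeas X]eq_fun do rewrite preE//.
by apply: cmeas_sumin => h j hm; apply: cmeas_actd; exact: IH.
Qed.

Lemma cmeas_tang m0 h0 B (G : W -> nat -> nat -> R) m i :
  (forall r b, cmeas (fun w => G w r b)) ->
  cmeas (fun w => tang N x m0 h0 B w (G w) m i).
Proof.
move=> mG; elim/ltn_ind: m i => m IH i; have [mm|mm|->] := ltngtP m m0.
- by under [X in cmeas X]eq_fun do rewrite tang_lt//; exact: cmeas_cst.
- under [X in cmeas X]eq_fun do rewrite tang_gt//.
  apply: cmeas_sumin => h j hm; apply: cmeas_actd; last exact: IH.
  by case: (B h j); [exact: IH|exact: cmeas_pre].
- under [X in cmeas X]eq_fun do rewrite tang_eq//.
  apply: cmeasM; first exact: cmeas_cst.
  apply: cmeas_sum => j; apply: cmeasM; first exact: mG.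
  by apply: cmeas_actd; exact: cmeas_pre.
Qed.

End MeasurableNetwork.

(* Blocks are numbered from 1, so this key is fresh: it carries the Gaussian   *)
(* direction along which the network is differentiated.                      *)
Definition kaux : wkey := WMid 0 0.

(** [wf_inj] lets one unit be flipped without touching other matrices. By [wf_rl] skip connections
    join linear layers only; otherwise a sign flip at a ReLU unit would leak through them. By
    [wf_sk1] at most one skip enters a layer, so skip contributions cannot cancel each other. *)
Record wf_net (R : realType) (N : net R) (M : nat) (s : seq wcoord) : Prop := WfNet {
  wf_uniq : uniq s;
  wf_mem : forall m h i j, (h < m <= M)%N -> edge N m h ->
    (i < dim N m)%N -> (j < dim N h)%N -> (key N m h, i, j) \in s;
  wf_inj : forall m h m' h', (h < m <= M)%N -> (h' < m' <= M)%N ->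
    edge N m h -> edge N m' h' -> key N m h = key N m' h' -> m = m' /\ h = h';
  wf_kaux : forall m h, (h < m <= M)%N -> edge N m h -> key N m h != kaux;
  wf_mem_kaux : forall c, c \in s -> c.1.1 != kaux;
  wf_dim : forall m h, (h < m <= M)%N -> sk N m h != 0 -> dim N m = dim N h;
  wf_rl : forall m h, (h < m <= M)%N -> sk N m h != 0 -> ~~ rl N m && ~~ rl N h;
  wf_sk1 : forall m h h', (h < m <= M)%N -> (h' < m <= M)%N ->
    sk N m h != 0 -> sk N m h' != 0 -> h = h' }.

(** * Exceptional weights *)

Section GoodWeights.
Variables (R : realType) (N : net R) (x : vec R) (M : nat) (s : seq wcoord).
Hypothesis wf : wf_net N M s.
Local Notation W := (weights R).
Local Notation dim := (dim N).
Local Notation rl := (rl N).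
Local Notation edge := (edge N).
Local Notation key := (key N).
Local Notation cf := (cf N).
Local Notation sk := (sk N).
Local Notation pre := (pre N x).
Local Notation post := (post N x).
Implicit Types (w : W) (m h i j : nat).

Lemma pre_upd_lt w m h r b t m' : (h < m <= M)%N -> edge m h -> (m' < m)%N ->
  pre (upd w (key m h, r, b) t) m' = pre w m'.
Proof.
move=> /andP[hm mM] e m'm; apply: pre_local => m1 h1 /andP[h1m m1m'] e1.
apply/funext => i; apply/funext => j; rewrite /upd; case: eqP => // -[kk _ _].
have [||mE _] := wf_inj wf _ _ e1 e kk; rewrite ?hm ?h1m//.
  by rewrite (leq_trans m1m')// (leq_trans (ltnW m'm)).
by move: m1m'; rewrite mE leqNgt m'm.
Qed.

Lemma post_upd_lt w m h r b t m' : (h < m <= M)%N -> edge m h -> (m' < m)%N ->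
  post (upd w (key m h, r, b) t) m' = post w m'.
Proof. by move=> hm e m'm; rewrite /post (pre_upd_lt _ _ _ _ hm e m'm). Qed.

Lemma pre_upd w m h r b t i : (h < m <= M)%N -> edge m h -> (b < dim h)%N ->
  pre (upd w (key m h, r, b) t) m i =
  pre w m i + (if i == r then (t - w (key m h) r b) * (cf m h * post w h b) else 0).
Proof.
move=> hmM e bh; have /andP[hm mM] := hmM.
have m_gt0 : (0 < m)%N by exact: leq_ltn_trans hm.
rewrite !preE// -sumin_upd//; last first.
  move=> h' h'm e' kk; have [||_ //] := wf_inj wf _ _ e' e kk => //.
  by rewrite h'm.
apply: eq_sumin => [h' h'm _ _|h' j h'm _ _ _]; by rewrite post_upd_lt.
Qed.

(** The condition does not mention the direction [G]: it asks for a nonzero signal on an edge into a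
    unit whose pre-activation vanishes. [good_tang] shows that this covers every kink met with
    nonzero speed. *)
Definition bad4 m i h j w : bool :=
  [&& (h < m <= M)%N, (i < dim m)%N, (j < dim h)%N, edge m h,
      cf m h * post w h j != 0 & pre w m i == 0].

Definition bad w : bool :=
  has (fun m => has (fun i => has (fun h => has (fun j => bad4 m i h j w)
    (iota 0 (dim h))) (iota 0 m)) (iota 0 (dim m))) (iota 0 M.+1).

Lemma good_edge w m i h j : ~~ bad w -> (h < m <= M)%N -> (i < dim m)%N ->
  (j < dim h)%N -> edge m h -> cf m h * post w h j != 0 -> pre w m i != 0.
Proof.
move=> gw hmM im jh e nz; apply: contra gw => z; have /andP[hm mM] := hmM.
apply/hasP; exists m; first by rewrite mem_iota.
apply/hasP; exists i; first by rewrite mem_iota.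
apply/hasP; exists h; first by rewrite mem_iota.
apply/hasP; exists j; first by rewrite mem_iota.
by rewrite /bad4 hmM im jh e nz.
Qed.

(** [post w h j] does not involve the matrices into layer [m], so [pre w m i] is affine in the entry
    [(i, j)] of [key m h], with slope [cf m h * post w h j]. This slope is nonzero on the event,
    which therefore has slices of at most one point. *)
Lemma null_bad s' : uniq s' -> {subset s <= s'} -> null s' bad.
Proof.
move=> us' ss'.
apply: null_has => m; apply: null_has => i; apply: null_has => h.
apply: null_has => j; rewrite /bad4.
case: (boolP (h < m <= M)%N) => hm; last exact: null_false.
case: (boolP (i < dim m)%N) => im; last exact: null_false.
case: (boolP (j < dim h)%N) => jh; last exact: null_false.
case: (boolP (edge m h)) => e; last exact: null_false.
apply: (@null_slice _ s' (key m h, i, j)) => //=.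
- by apply: ss'; exact: wf_mem wf _ _ _ _ hm e im jh.
- apply: cmeas_and; last by apply: cmeas_eq0; exact: cmeas_pre.
  apply: cmeas_neg; apply: cmeas_eq0; apply: cmeasM; first exact: cmeas_cst.
  by apply: cmeas_actd; exact: cmeas_pre.
- have /andP[hm1 _] := hm.
  move=> w t t'; rewrite !(post_upd_lt _ _ _ _ hm e hm1) !(pre_upd _ _ _ _ hm e jh) eqxx.
  move=> /andP[nz /eqP z1] /andP[_ /eqP z2].
  have : (t - t') * (cf m h * post w h j) = 0 by rewrite -(subrr 0) -{1}z1 -z2; ring.
  by move/eqP; rewrite mulf_eq0 (negbTE nz) orbF subr_eq0 => /eqP.
Qed.

Variables m0 h0 : nat.
Hypotheses (hm0 : (h0 < m0 <= M)%N) (e0 : edge m0 h0).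
Local Notation tang := (tang N x m0 h0).
Local Notation ptang := (ptang N x m0 h0).
Local Notation none := (fun _ _ : nat => false).

Lemma neq0_sum (I : finType) (P : pred I) (f : I -> R) :
  \sum_(q | P q) f q != 0 -> exists2 q, P q & f q != 0.
Proof.
move=> nz; apply/exists_inP; apply: contraR nz => /exists_inPn nex.
by rewrite big1// => q Pq; apply/eqP; rewrite -[_ == _]negbK nex.
Qed.

(** A nonzero derivative arrives along a path of open gates, and such a path also carries a nonzero
    signal. At linear layers the signal may sit at another unit than [i], because of the skip
    connections; hence the existential, which is what the induction needs. *)
Lemma good_tang w G m i : ~~ bad w -> (m0 <= m <= M)%N -> (i < dim m)%N ->
  tang none w G m i != 0 ->
  (exists2 i', (i' < dim m)%N & pre w m i' != 0) /\ (rl m -> pre w m i != 0).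
Proof.
move=> gw; elim/ltn_ind: m i => m IH i /andP[mm mM] im.
move: mm; rewrite leq_eqVlt => /predU1P[mE|mm].
  subst m; rewrite tang_eq mulf_eq0 negb_or => /andP[cf0 /neq0_sum[j _]].
  rewrite mulf_eq0 negb_or => /andP[_ pj].
  have : pre w m0 i != 0.
    by apply: (good_edge gw hm0 im (ltn_ord j) e0); rewrite mulf_neq0.
  by move=> nz; split=> //; exists i.
rewrite tang_gt// /sumin => nz.
have from_edge h j : (h < m)%N -> (j < dim h)%N -> edge m h ->
    cf m h * post w h j != 0 ->
    (exists2 i', (i' < dim m)%N & pre w m i' != 0) /\ (rl m -> pre w m i != 0).
  move=> hm jh e pj.
  have nz' : pre w m i != 0 by apply: (good_edge gw _ im jh e pj); rewrite hm.
  by split=> //; exists i.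
(* Either some edge into [m] carries a nonzero signal, and then every unit of layer [m] is nonzero
   since [w] is good, or [pre w m] reduces to its only skip connection. *)
have [[h [j [hm jh e pj]]]|noedge] := pselect (exists h j,
  [/\ (h < m)%N, (j < dim h)%N, edge m h & cf m h * post w h j != 0]).
  exact: from_edge e pj.
have : (\sum_(h < m | (m0 <= h)%N) sk m h * ptang none w G h i != 0) ||
    (\sum_(h < m | (m0 <= h)%N && edge m h) cf m h *
       (\sum_(j < dim h) w (key m h) i j * ptang none w G h j) != 0).
  by rewrite -negb_and; apply: contra nz => /andP[/eqP -> /eqP ->]; rewrite addr0.
case/orP => /neq0_sum[h].
  move=> mh; rewrite mulf_eq0 negb_or => /andP[sk0 ph0].
  have hmM : (h < m <= M)%N by rewrite ltn_ord mM.
  have /andP[rm rh] := wf_rl wf hmM sk0.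
  move: ph0; rewrite /ptang /actd (negbTE rh) => th0.
  have [|||[i' i'h pi'] _] := IH h _ i _ _ th0 => //.
  - by rewrite mh (leq_trans (ltnW (ltn_ord h))).
  - by rewrite -(wf_dim wf hmM sk0).
  split; last by rewrite (negbTE rm).
  exists i'; first by rewrite (wf_dim wf hmM sk0).
  rewrite preE; last exact: leq_ltn_trans (ltn_ord h).
  rewrite /sumin [X in _ + X]big1 ?addr0; last first.
    move=> h1 /andP[_ eh1]; apply/eqP; rewrite -[_ == _]negbK; apply/negP => nz1.
    move: nz1; rewrite mulf_eq0 negb_or => /andP[cf1 /neq0_sum[j _]].
    rewrite mulf_eq0 negb_or => /andP[_ pj]; apply: noedge.
    by exists h1, j; split=> //; rewrite mulf_neq0.
  rewrite (bigD1 h)//= big1 ?addr0; last first.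
    move=> h1 h1h; case: (eqVneq (sk m h1) 0) => [->|sk1]; first by rewrite mul0r.
    case/eqP: h1h; apply: val_inj; apply: (wf_sk1 wf _ hmM) sk1 sk0.
    by rewrite ltn_ord mM.
  by rewrite mulf_neq0// /post /actd (negbTE rh).
move=> /andP[mh eh]; rewrite mulf_eq0 negb_or => /andP[cf0 /neq0_sum[j _]].
rewrite mulf_eq0 negb_or => /andP[_ pj].
exfalso; apply: noedge.
move: pj; rewrite /ptang /actd; case: (boolP (rl h)) => rh pj.
  exists h, j; split=> //; rewrite mulf_neq0// /post /actd rh.
  move: pj; rewrite !mulf_eq0 !negb_or => /and3P[-> g0 _] /=.
  rewrite g0/=; move: g0; case: ltP => [p0 _|]; last by rewrite eqxx.
  exact: lt0r_neq0.
have [|||[j' j'h pj'] _] := IH h _ j _ _ pj => //.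
  by rewrite mh (leq_trans (ltnW (ltn_ord h))).
by exists h, j'; split=> //; rewrite mulf_neq0// /post /actd (negbTE rh).
Qed.

Lemma good_gate w G m i : ~~ bad w -> (m0 <= m <= M)%N -> (i < dim m)%N ->
  rl m -> pre w m i = 0 -> tang none w G m i = 0.
Proof.
move=> gw mm im rm z; apply/eqP; apply: contraT => nz.
by have [_ /(_ rm)] := good_tang gw mm im nz; rewrite z eqxx.
Qed.

End GoodWeights.

(** * Differentiation off the exceptional set *)

Section LocallyAffine.
Variable R : realType.

(** Away from $y = 0$ the sign is locally constant, so the gate is frozen; at $y = 0$ the hypothesis
    forces the path to stand still. *)
Lemma actd_near (r : bool) (f : R -> R) (y v t0 : R) : (r -> y = 0 -> v = 0) ->
  (\forall t \near t0, f t = y + (t - t0) * v) ->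
  \forall t \near t0, actd r (f t) (f t) = actd r y y + (t - t0) * actd r y v.
Proof.
case: r => // /(_ isT) yv fE.
have [y0|y0] := eqVneq y 0.
  near=> t; have -> : f t = y by rewrite [LHS](near fE t)// yv// mulr0 addr0.
  by rewrite yv// actd0 mulr0 addr0.
(* Within this radius the variation stays below [|y|]; the [+ 1] keeps the denominator positive when
   [v = 0]. *)
have e0 : 0 < `|y| / (`|v| + 1) by rewrite divr_gt0 ?normr_gt0// ltr_wpDl.
near=> t; have ft : f t = y + (t - t0) * v by exact: (near fE t).
have lt_y : `|(t - t0) * v| < `|y|.
  have : `|t - t0| < `|y| / (`|v| + 1).
    near: t; apply/nbhs_ballP; exists (`|y| / (`|v| + 1)) => // t /=.
    by rewrite /ball/= distrC.
  rewrite ltr_pdivlMr ?ltr_wpDl// normrM; apply: le_lt_trans.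
  by rewrite ler_wpM2l// lerDl.
have sE : (0 < f t) = (0 < y).
  rewrite ft; move: lt_y; rewrite ltr_norml.
  case: (ltP 0 y) => [yp|yn].
    by rewrite gtr0_norm// => /andP[h _]; lra.
  by rewrite ler0_norm// => /andP[_ h]; apply/negbTE; rewrite -leNgt; lra.
by rewrite /actd sE ft; ring.
Unshelve. all: by end_near. Qed.

Lemma derive1_near_affine (f : R -> R) (t0 J : R) :
  (\forall t \near t0, f t = f t0 + (t - t0) * J) -> derive1 f t0 = J.
Proof.
move=> /nbhs_ballP[e /= e0 fE]; apply: cvg_lim => //.
apply: cvg_near_cst; near=> h.
have h0 : h != 0 by near: h; exact: nbhs_dnbhs_neq.
rewrite fE.
  by rewrite /GRing.scale/= addrK (addrC (f t0)) addrK mulKf.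
rewrite /ball/= opprD addrCA subrr addr0 normrN.
near: h; apply/nbhs_ballP; exists e => // h /=.
by rewrite /ball/= sub0r normrN.
Unshelve. all: by end_near. Qed.

End LocallyAffine.

Section Derivative.
Variables (R : realType) (N : net R) (x : vec R) (M : nat) (s : seq wcoord).
Hypothesis wf : wf_net N M s.
Variables m0 h0 : nat.
Hypotheses (hm0 : (h0 < m0 <= M)%N) (e0 : edge N m0 h0).
Local Notation W := (weights R).
Local Notation dim := (dim N).
Local Notation rl := (rl N).
Local Notation edge := (edge N).
Local Notation key := (key N).
Local Notation cf := (cf N).
Local Notation sk := (sk N).
Local Notation pre := (pre N x).
Local Notation post := (post N x).
Local Notation bad := (bad N x M).
Local Notation tang := (tang N x m0 h0).
Local Notation ptang := (ptang N x m0 h0).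
Local Notation none := (fun _ _ : nat => false).
Implicit Types (w : W) (m h i j : nat).

Definition delta (r b i j : nat) : R := ((i == r) && (j == b))%:R.

Lemma sum_delta r b i n (f : nat -> R) : (b < n)%N ->
  \sum_(j < n) delta r b i j * f j = if i == r then f b else 0.
Proof.
move=> bn; rewrite (bigD1 (Ordinal bn))//= big1 ?addr0.
  by rewrite /delta eqxx andbT; case: eqP; rewrite ?mul1r ?mul0r.
move=> j /eqP jb; rewrite /delta; case: (j =P b :> nat) => [jE|_].
  by case: jb; exact: val_inj.
by rewrite andbF mul0r.
Qed.

(** Forward differentiation layer by layer. [good_gate] supplies the condition of [actd_near] at
    each ReLU unit, so the expansion is exact near the point and not merely of first order. *)
Lemma pre_near w r b m i : ~~ bad w -> (r < dim m0)%N -> (b < dim h0)%N ->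
  (m <= M)%N -> (i < dim m)%N ->
  \forall t \near w (key m0 h0) r b,
    pre (upd w (key m0 h0, r, b) t) m i =
    pre w m i + (t - w (key m0 h0) r b) * tang none w (delta r b) m i.
Proof.
move=> gw rm0 bh0; set t0 := w _ r b; set D := delta r b.
elim/ltn_ind: m i => m IH i mM im; have [mm|mm|mm] := ltngtP m m0.
- near=> t; rewrite (pre_upd_lt _ wf)// tang_lt//.
  by rewrite mulr0 addr0.
- have post_near (h : 'I_m) (j : 'I_(dim h)) : \forall t \near t0,
      post (upd w (key m0 h0, r, b) t) h j =
      post w h j + (t - t0) * ptang none w D h j.
    have hM : (h <= M)%N by rewrite (leq_trans (ltnW (ltn_ord h))).
    apply: actd_near => [rh z|]; last exact: IH.
    have [hm|mh] := ltnP h m0; first by rewrite tang_lt.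
    by apply: (good_gate wf hm0 e0 D gw) => //; rewrite mh.
  have all_near : \forall t \near t0, forall (h : 'I_m) (j : 'I_(dim h)),
      post (upd w (key m0 h0, r, b) t) h j =
      post w h j + (t - t0) * ptang none w D h j.
    apply: (filter_forall (F := nbhs t0)) => h.
    by apply: (filter_forall (F := nbhs t0)) => j; exact: post_near.
  near=> t; have tE := near all_near t.
  have m_gt0 : (0 < m)%N by exact: leq_ltn_trans mm.
  rewrite preE// tang_gt// preE//.
  rewrite -(@sumin_keep _ N w m (leq m0)); last first.
    by move=> h j _; rewrite -ltnNge => hm; rewrite ptang_lt.
  rewrite -sumin_affine; apply: eq_sumin => [h hm _ sk0|h j hm _ e jh].
    have ih : (i < dim h)%N by rewrite -(wf_dim wf _ sk0)// hm.
    by rewrite (tE _ (Ordinal hm) (Ordinal ih)).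
  rewrite (tE _ (Ordinal hm) (Ordinal jh))//; congr (_ * _).
  rewrite /upd; case: eqP => // -[kk _ _].
  have [|mE _] := wf_inj wf _ hm0 e e0 kk; rewrite ?hm//.
  by move: mm; rewrite mE ltnn.
- near=> t; subst m; rewrite (pre_upd _ wf)//; congr (_ + _).
  rewrite tang_eq sum_delta//; case: ifP => // _; by rewrite !mulr0.
Unshelve. all: by end_near. Qed.

(** With gates read from the network itself, the propagation is linear in [G]; at the output it is
    the pairing of [G] with the Jacobian. *)
Lemma tang_linear w G m i : (m <= M)%N -> (i < dim m)%N ->
  tang none w G m i = \sum_(q : 'I_(dim m0) * 'I_(dim h0))
    G q.1 q.2 * tang none w (delta q.1 q.2) m i.
Proof.
elim/ltn_ind: m i => m IH i mM im; have [mm|mm|mm] := ltngtP m m0.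
- by rewrite tang_lt// big1// => q _; rewrite tang_lt// mulr0.
- rewrite tang_gt//; under eq_bigr do rewrite tang_gt//.
  rewrite -sumin_lin.
  have pE h j : (h < m)%N -> (j < dim h)%N -> ptang none w G h j =
      \sum_(q : 'I_(dim m0) * 'I_(dim h0)) G q.1 q.2 * ptang none w (delta q.1 q.2) h j.
    move=> hm jh; rewrite {1}/ptang IH//; last by rewrite (leq_trans (ltnW hm)).
    by rewrite actd_lin.
  apply: eq_sumin => [h hm _ sk0|h j hm _ e jh]; rewrite pE//.
  by rewrite -(wf_dim wf _ sk0)// hm.
- subst m; rewrite tang_eq.
  under [RHS]eq_bigr do rewrite tang_eq sum_delta//.
  rewrite -(pair_bigA _ (fun (r : 'I_(dim m0)) (b : 'I_(dim h0)) => G r b *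
    (cf m0 h0 * if i == r then post w h0 b else 0)))/=.
  rewrite (bigD1 (Ordinal im))//= [X in _ + X]big1 ?addr0.
    rewrite mulr_sumr; apply: eq_bigr => j _; rewrite eqxx; ring.
  move=> r /eqP ri; rewrite big1// => j _.
  case: eqP => [iE|_]; last by rewrite !mulr0.
  by case: ri; exact: val_inj.
Qed.

Definition jac w (r b : nat) : R := tang none w (delta r b) M 0.

Lemma jac_sqnormE w : ~~ bad w -> (0 < dim M)%N ->
  jac_sqnorm (fun w => pre w M 0) w (key m0 h0) (dim m0) (dim h0) =
  \sum_(i < dim m0) \sum_(j < dim h0) jac w i j ^+ 2.
Proof.
move=> gw dM; apply: eq_bigr => i _; apply: eq_bigr => j _; congr (_ ^+ 2).
apply: derive1_near_affine.
have -> : upd w (key m0 h0, i : nat, j : nat) (w (key m0 h0) i j) = w.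
  apply/funext => k; apply/funext => i'; apply/funext => j'.
  by rewrite /upd; case: eqP => // -[-> -> ->].
exact: pre_near.
Qed.

End Derivative.

(** * Exchange of the gates by sign flips *)

Section SignFlips.
Variables (R : realType) (N : net R) (x : vec R) (M : nat) (s : seq wcoord).
Hypothesis wf : wf_net N M s.
Variables m0 h0 : nat.
Hypotheses (hm0 : (h0 < m0 <= M)%N) (e0 : edge N m0 h0).
Local Notation W := (weights R).
Local Notation dim := (dim N).
Local Notation rl := (rl N).
Local Notation edge := (edge N).
Local Notation key := (key N).
Local Notation cf := (cf N).
Local Notation sk := (sk N).
Local Notation pre := (pre N x).
Local Notation post := (post N x).
Local Notation bad := (bad N x M).
Local Notation tang := (tang N x m0 h0).
Local Notation ptang := (ptang N x m0 h0).
Local Notation none := (fun _ _ : nat => false).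
Implicit Types (w : W) (m h i j r b : nat) (B : nat -> nat -> bool).

Definition vout B w m : vec R := tang B w (w kaux) m.
Definition pout B w m : vec R := ptang B w (w kaux) m.

(* The weights whose reversal changes the sign of unit [i] of layer [m] and   *)
(* hides it from the layers above: incoming rows and outgoing columns.       *)
Definition unit_coords m i : pred wcoord := fun c =>
  [|| has (fun h => edge m h && (key m h == c.1.1)) (iota 0 m) && (c.1.2 == i),
      [&& m == m0, c.1.1 == kaux & c.1.2 == i]
    | has (fun m' => edge m' m && (key m' m == c.1.1)) (iota m.+1 (M - m))
      && (c.2 == i)].

Section Unit.
Variables (m i : nat).
Hypotheses (mm : (m0 <= m)%N) (mM : (m <= M)%N) (rm : rl m).
Local Notation fl := (flip (unit_coords m i)).

Lemma unit_coords_key m1 h1 r b : (h1 < m1 <= M)%N -> edge m1 h1 ->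
  unit_coords m i (key m1 h1, r, b) =
  ((m1 == m) && (r == i)) || ((h1 == m) && (b == i)).
Proof.
move=> hm1 e1; rewrite /unit_coords/= (negbTE (wf_kaux wf hm1 e1)) andbF/=.
congr (_ && _ || _ && _).
  apply/hasP/eqP => [[h]|mE].
    rewrite mem_iota/= add0n => hm /andP[e /eqP kk].
    by have [|-> _] := wf_inj wf _ hm1 e e1 kk; rewrite ?hm.
  subst m1; have /andP[hm _] := hm1.
  by exists h1; rewrite ?mem_iota// e1 eqxx.
apply/hasP/eqP => [[m']|hE].
  rewrite mem_iota addSn subnKC// ltnS => /andP[mm' m'M] /andP[e /eqP kk].
  by have [|_ ->] := wf_inj wf _ hm1 e e1 kk; rewrite ?mm'.
subst h1; have /andP[hm m1M] := hm1.
by exists m1; rewrite ?mem_iota ?addSn ?subnKC// ?ltnS ?hm// e1 eqxx.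
Qed.

Lemma unit_coords_kaux r b : unit_coords m i (kaux, r, b) = (m == m0) && (r == i).
Proof.
rewrite /unit_coords/=.
set H1 := has _ _; set H2 := has _ _.
have -> : H1 = false.
  apply/hasP => -[h]; rewrite mem_iota/= add0n => hm /andP[e kk].
  by have := @wf_kaux _ _ _ _ wf m h; rewrite hm mM kk => /(_ isT e).
have -> : H2 = false.
  apply/hasP => -[m']; rewrite mem_iota addSn subnKC// ltnS => /andP[mm' m'M] /andP[e kk].
  by have := @wf_kaux _ _ _ _ wf m' m; rewrite mm' m'M kk => /(_ isT e).
by rewrite /= orbF.
Qed.

Lemma flip_key w m1 h1 r b : (h1 < m1 <= M)%N -> edge m1 h1 ->
  fl w (key m1 h1) r b = if ((m1 == m) && (r == i)) || ((h1 == m) && (b == i))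
                         then - w (key m1 h1) r b else w (key m1 h1) r b.
Proof. by move=> hm1 e1; rewrite /flip unit_coords_key. Qed.

Lemma flip_key_lt w m1 h1 : (h1 < m1)%N -> (m1 < m)%N -> edge m1 h1 ->
  fl w (key m1 h1) = w (key m1 h1).
Proof.
move=> hm1 m1m e1; apply/funext => r; apply/funext => b; rewrite flip_key//.
  by rewrite (ltn_eqF m1m) (ltn_eqF (ltn_trans hm1 m1m)).
by rewrite hm1 (leq_trans (ltnW m1m)).
Qed.

Lemma pre_flip_lt w m' : (m' < m)%N -> pre (fl w) m' = pre w m'.
Proof.
move=> m'm; apply: pre_local => m1 h1 /andP[hm1 m1m'] e1.
by rewrite flip_key_lt// (leq_ltn_trans m1m').
Qed.

Let sk0 h : (h < m)%N -> sk m h = 0.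
Proof.
move=> hm; apply/eqP; apply: contraT => skn.
by have := @wf_rl _ _ _ _ wf m h; rewrite hm mM rm => /(_ isT skn).
Qed.

Lemma pre_flip w j : pre (fl w) m j = if j == i then - pre w m j else pre w m j.
Proof.
have m_gt0 : (0 < m)%N.
  by rewrite (leq_trans _ mm)//; case/andP: hm0 => + _; exact: leq_ltn_trans.
rewrite !preE//.
have -> : sumin N (fl w) m predT (post (fl w)) j = sumin N (fl w) m predT (post w) j.
  by apply: eq_sumin => [h hm _ _|h b hm _ _ _]; rewrite /post pre_flip_lt.
case: eqP => ji.
  apply: suminN => // h b hm _ e.
  by rewrite flip_key ?hm// eqxx ji eqxx.
apply: eq_sumin => // h b hm _ e _.
by rewrite flip_key ?hm// (introF eqP ji) andbF ltn_eqF.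
Qed.

Lemma vout_flip_lt B w h j : (h < m)%N -> (j < dim h)%N -> vout B (fl w) h j = vout B w h j.
Proof.
move=> hm jh; have [hm0'|mh] := ltnP h m0; first by rewrite /vout !tang_lt.
apply: (tang_local (wf_dim wf)) => //.
- exact: leq_trans (ltnW hm) mM.
- rewrite /post pre_flip_lt//.
  by rewrite (leq_trans _ mm)//; case/andP: hm0.
- by move=> h' i' /andP[_ h'h] _ _ _; rewrite pre_flip_lt// (ltn_trans h'h).
- move=> r b _ _; rewrite /flip unit_coords_kaux gtn_eqF//.
  exact: leq_ltn_trans mh hm.
- move=> m' h' /andP[mm' m'h] /andP[_ h'm'] e; rewrite flip_key_lt//.
  exact: leq_ltn_trans m'h hm.
Qed.

Lemma pout_flip_lt B w h j : (h < m)%N -> (j < dim h)%N -> pout B (fl w) h j = pout B w h j.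
Proof.
move=> hm jh; rewrite /pout /ptang.
by rewrite -/(vout B (fl w) h j) vout_flip_lt// pre_flip_lt.
Qed.

Lemma vout_flip B w j : vout B (fl w) m j = if j == i then - vout B w m j else vout B w m j.
Proof.
rewrite /vout; move: mm; rewrite leq_eqVlt => /predU1P[mE|mlt].
  have tE w1 G j1 : tang B w1 G m j1 =
      cf m0 h0 * \sum_(b < dim h0) G j1 b * post w1 h0 b by rewrite -mE tang_eq.
  rewrite !tE; have -> : post (fl w) h0 = post w h0.
    by rewrite /post pre_flip_lt// -mE; case/andP: hm0.
  have E b : fl w kaux j b = if j == i then - w kaux j b else w kaux j b.
    by rewrite {1}/flip unit_coords_kaux -mE eqxx.
  under eq_bigr do rewrite E.
  case: eqP => // _; under eq_bigr do rewrite mulNr.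
  by rewrite sumrN mulrN.
rewrite !tang_gt//.
have -> : sumin N (fl w) m (leq m0) (ptang B (fl w) (fl w kaux)) j =
          sumin N (fl w) m (leq m0) (ptang B w (w kaux)) j.
  apply: eq_sumin => [h hm _ /eqP[]|h b hm _ _ bh]; first exact: sk0.
  by rewrite -/(pout B (fl w) h b) pout_flip_lt.
case: eqP => ji.
  apply: suminN => // h b hm _ e.
  by rewrite flip_key ?hm// eqxx ji eqxx.
apply: eq_sumin => // h b hm _ e _.
by rewrite flip_key ?hm// (introF eqP ji) andbF ltn_eqF.
Qed.

(** The event that the two candidate gates have opposite signs. Both factors change sign under the
    flip, so the event is invariant, as [gaussE_cond_flip] requires. *)
Definition sg w := pre w m i * vout none w m i < 0.

Lemma sg_flip w : sg (fl w) = sg w.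
Proof. by rewrite /sg pre_flip vout_flip eqxx mulrNN. Qed.

Definition align w := if sg w then fl w else w.

Hypothesis (mltM : (m < M)%N) (im : (i < dim m)%N).
Variables B B' : nat -> nat -> bool.
Hypotheses (B_lt : forall h j, (h < m)%N -> B h j = false)
  (B_gt : forall h j, (m < h)%N -> B h j) (B_unit : B m i = false)
  (B'_unit : B' m i) (BB' : forall h j, (h != m) || (j != i) -> B' h j = B h j).

Definition flip_sign w : R := if sg w then -1 else 1.

Let pre_align_lt w h : (h < m)%N -> pre (align w) h = pre w h.
Proof. by rewrite /align; case: ifP => // _; exact: pre_flip_lt. Qed.

Let pre_align w j : pre (align w) m j = (if j == i then flip_sign w else 1) * pre w m j.
Proof.
by rewrite /align /flip_sign; case: (sg w); rewrite ?pre_flip; case: eqP; rewrite ?mul1r ?mulN1r.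
Qed.

Let vout_align_lt C w h j : (h < m)%N -> (j < dim h)%N ->
  vout C (align w) h j = vout C w h j.
Proof.
rewrite /align => hm jh; case: (sg w); last by [].
by apply: vout_flip_lt.
Qed.

Let vout_align C w j : vout C (align w) m j = (if j == i then flip_sign w else 1) * vout C w m j.
Proof.
by rewrite /align /flip_sign; case: (sg w); rewrite ?vout_flip; case: eqP; rewrite ?mul1r ?mulN1r.
Qed.

Let vout_B w h j : (h <= m)%N -> (j < dim h)%N -> vout B' w h j = vout B w h j.
Proof.
move=> hm jh; apply: (tang_local (wf_dim wf)) => //; first exact: leq_trans hm mM.
move=> h' i' /andP[_ h'h] _ _; apply: BB'.
by rewrite ltn_eqF// (leq_trans h'h).
Qed.

Let vout_none w : vout B w m i = vout none w m i.
Proof.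
apply: (tang_local (wf_dim wf)) => // h' i' /andP[_ h'm] _ _.
exact: B_lt.
Qed.

(** After alignment the propagated value has the sign that the pre-activation had before, so the new
    gate reproduces the old one and only [flip_sign] remains. Good weights exclude a zero
    pre-activation with a nonzero propagated value, where the gates could not be matched. *)
Lemma pout_align w j : ~~ bad w -> (j < dim m)%N ->
  pout B' (align w) m j = (if j == i then flip_sign w else 1) * pout B w m j.
Proof.
move=> gw jm; rewrite /pout /ptang -/(vout B' (align w) m j) -/(vout B w m j).
rewrite vout_align vout_B// pre_align /actd rm.
case: (j =P i) => [->|/eqP ji]; last by rewrite !mul1r BB' ?ji ?orbT.
rewrite B'_unit B_unit vout_none.
have z0 : pre w m i = 0 -> vout none w m i = 0.
  by apply: (good_gate wf hm0 e0 _ gw) => //; rewrite mm.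
have [z|nz] := eqVneq (pre w m i) 0; first by rewrite z0// !mulr0.
have [v0|nv] := eqVneq (vout none w m i) 0; first by rewrite v0 !mulr0.
rewrite /flip_sign; case: (boolP (sg w)); rewrite /sg => sgn.
  rewrite mulN1r oppr_gt0.
  have -> : (vout none w m i < 0) = (0 < pre w m i).
    by case: (ltgtP (pre w m i) 0) nz => // p0 _;
       [rewrite nmulr_rlt0 in sgn|rewrite pmulr_rlt0 in sgn];
       rewrite ?sgn//; apply/negbTE; rewrite -leNgt ltW.
  by rewrite !mulN1r !mulrN.
rewrite !mul1r -leNgt in sgn *.
have -> : (0 < vout none w m i) = (0 < pre w m i).
  case: (ltgtP (pre w m i) 0) nz => // p0 _.
    by rewrite nmulr_rge0// in sgn; apply/negbTE; rewrite -leNgt.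
  by rewrite pmulr_rge0// in sgn; rewrite lt_def nv.
by [].
Qed.

(** The factor [flip_sign] appears once in the output of the unit and once in its outgoing column,
    and cancels. The flip may alter [pre] above layer [m], but by [B_gt] the gates there no longer
    read it: this is why the exchange runs from the top down. *)
Lemma vout_align_gt w m' j : ~~ bad w -> (m < m' <= M)%N -> (j < dim m')%N ->
  vout B' (align w) m' j = vout B w m' j.
Proof.
move=> gw; elim/ltn_ind: m' j => m' IH j /andP[mm' m'M] jm'.
have m0m' : (m0 < m')%N by exact: leq_ltn_trans mm mm'.
rewrite /vout !tang_gt//.
have poutE h b : (h < m')%N -> h != m -> (b < dim h)%N ->
    pout B' (align w) h b = pout B w h b.
  move=> hm' hm bh; rewrite /pout /ptang.
  rewrite -/(vout B' (align w) h b) -/(vout B w h b) BB' ?hm//.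
  move: hm; rewrite neq_ltn => /orP[hm|hm].
    by rewrite vout_align_lt// vout_B ?(ltnW hm)// pre_align_lt.
  by rewrite IH ?hm ?(leq_trans (ltnW hm'))// B_gt.
apply: eq_sumin => [h hm' _ skn|h b hm' _ eh bh].
  have hM : (h < m' <= M)%N by rewrite hm'.
  apply: poutE => //; last by rewrite -(wf_dim wf hM skn).
  by apply: contraTneq rm => <-; case/andP: (wf_rl wf hM skn).
have hM : (h < m' <= M)%N by rewrite hm'.
have wE : align w (key m' h) j b =
    (if (h == m) && (b == i) then flip_sign w else 1) * w (key m' h) j b.
  rewrite /align /flip_sign; case: (sg w); last by rewrite if_same mul1r.
  rewrite flip_key// gtn_eqF//=; case: ifP; by rewrite ?mulN1r ?mul1r.
rewrite wE -/(pout B' (align w) h b) -/(pout B w h b).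
have [hm|hm] := eqVneq h m; last by rewrite mul1r poutE.
subst h; rewrite pout_align//=; case: eqP => _; last by rewrite !mul1r.
rewrite mulrACA [X in X * _](_ : _ = 1) ?mul1r//.
by rewrite /flip_sign; case: (sg w); rewrite ?mulrNN mulr1.
Qed.

Lemma gaussE_align s' (F : R -> \bar R) : uniq s' -> {subset s <= s'} ->
  measurable_fun setT F -> (forall y, 0 <= F y)%E -> (0 < dim M)%N ->
  gaussE s' (fun w => F (vout B w M 0)) = gaussE s' (fun w => F (vout B' w M 0)).
Proof.
move=> us' ss' mF F0 dM.
have mv C m1 j : cmeas (fun w => vout C w m1 j).
  by apply: cmeas_tang => r b; exact: cmeas_at.
have mFv C : cmeas (fun w => F (vout C w M 0)).
  exact: (@cmeas_comp _ _ _ _ _ F (fun w => vout C w M 0) mF (mv C M 0%N)).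
rewrite -(gaussE_cond_flip (A := unit_coords m i) (sg := sg) s' _ (mFv B'))//.
- apply/esym/(eq_gaussE_null (null_bad x wf us' ss')) => // w gw.
  by rewrite -/(align w) vout_align_gt// mltM leqnn.
- apply: cmeas_lt; last exact: cmeas_cst.
  by apply: cmeasM; [exact: cmeas_pre|exact: mv].
- exact: sg_flip.
Qed.

End Unit.

Definition from_layer n (h _ : nat) := (n <= h)%N.

Variable s' : seq wcoord.
Hypotheses (us' : uniq s') (ss' : {subset s <= s'}) (dM : (0 < dim M)%N).
Variable F : R -> \bar R.
Hypotheses (mF : measurable_fun setT F) (F0 : forall y, (0 <= F y)%E).

Let eq_vout B B' w :
  (forall h i, (m0 <= h < M)%N -> (i < dim h)%N -> rl h -> B h i = B' h i) ->
  vout B w M 0 = vout B' w M 0.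
Proof. by move=> BB'; apply: (tang_local (wf_dim wf)). Qed.

(** The units of the layer are exchanged one after another, [Bi i0] being the state after the first
    [i0] of them. Below [m0] and at linear layers no gate is read and nothing changes. *)
Lemma gaussE_layer m : (m < M)%N ->
  gaussE s' (fun w => F (vout (from_layer m.+1) w M 0)) =
  gaussE s' (fun w => F (vout (from_layer m) w M 0)).
Proof.
move=> mM.
have triv : (forall h i : nat, (m0 <= h < M)%N -> (i < dim h)%N -> rl h -> h != m) ->
    gaussE s' (fun w => F (vout (from_layer m.+1) w M 0)) =
    gaussE s' (fun w => F (vout (from_layer m) w M 0)).
  move=> neq; apply: eq_gauss_iter => w; congr F; apply: eq_vout => h i hm ih rh.
  by rewrite /from_layer ltn_neqAle eq_sym (neq h i).
have [mm|mm] := ltnP m m0.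
  by apply: triv => h i /andP[mh _] _ _; rewrite gtn_eqF// (leq_trans mm).
case: (boolP (rl m)) => rm; last first.
  by apply: triv => h i _ _ rh; apply: contraNneq rm => <-.
pose Bi i0 h j := (m < h)%N || (h == m) && (j < i0)%N.
have step i0 : (i0 <= dim m)%N ->
    gaussE s' (fun w => F (vout (from_layer m.+1) w M 0)) =
    gaussE s' (fun w => F (vout (Bi i0) w M 0)).
  elim: i0 => [_|i0 IH im].
    by apply: eq_gauss_iter => w; congr F; apply: eq_vout => h i _ _ _;
       rewrite /Bi /from_layer ltn0 andbF orbF.
  rewrite IH; last exact: ltnW.
  apply: (@gaussE_align m i0 mm (ltnW mM) rm mM im) => //.
  - by move=> h j hm; rewrite /Bi ltnNge (ltnW hm) ltn_eqF.
  - by move=> h j hm; rewrite /Bi hm.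
  - by rewrite /Bi !ltnn andbF.
  - by rewrite /Bi eqxx ltnS leqnn orbT.
  - move=> h j; rewrite /Bi; have [->|//] := eqVneq h m; rewrite ltnn /= => ji.
    by rewrite ltnS leq_eqVlt (negbTE ji).
rewrite (step _ (leqnn _)); apply: eq_gauss_iter => w; congr F.
apply: eq_vout => h i _ ih _; rewrite /Bi /from_layer.
rewrite [RHS]leq_eqVlt [m == h]eq_sym; have [hE|_] := eqVneq h m; last exact: orbF.
by rewrite /= -hE ih orbT.
Qed.

Lemma gaussE_none_all :
  gaussE s' (fun w => F (vout none w M 0)) =
  gaussE s' (fun w => F (vout (fun _ _ => true) w M 0)).
Proof.
have step n : (n <= M)%N -> gaussE s' (fun w => F (vout none w M 0)) =
    gaussE s' (fun w => F (vout (from_layer (M - n)) w M 0)).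
  elim: n => [_|n IH nM].
    apply: eq_gauss_iter => w; congr F; apply: eq_vout => h i /andP[_ hM] _ _.
    by rewrite /from_layer subn0 leqNgt hM.
  rewrite IH; last exact: ltnW.
  rewrite subnS -[in LHS](@prednK (M - n)) ?subn_gt0// gaussE_layer//.
  by rewrite prednK ?subn_gt0// leq_subr.
rewrite (step M)// subnn.
by apply: eq_gauss_iter => w; congr F; apply: eq_vout.
Qed.

End SignFlips.

Lemma mem_mcoords k r c (q : wcoord) :
  (q \in mcoords k r c) = [&& q.1.1 == k, (q.1.2 < r)%N & (q.2 < c)%N].
Proof.
case: q => -[k' i] j /=; apply/allpairsP/and3P => [[[i' j'] /= []]|[/eqP -> ir jc]].
  by rewrite !mem_iota /= !add0n => ? ? [-> -> ->].
by exists (i, j); rewrite !mem_iota.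
Qed.

Lemma uniq_mcoords k r c : uniq (mcoords k r c).
Proof. by apply: allpairs_uniq; rewrite ?iota_uniq// => -[i j] [i' j'] _ _ [-> ->]. Qed.

Lemma big_mcoords (R : realType) k r c (f : wcoord -> R) :
  \sum_(q <- mcoords k r c) f q = \sum_(i < r) \sum_(j < c) f (k, i : nat, j : nat).
Proof.
rewrite /mcoords big_allpairs_dep -[r in iota 0 r]subn0 big_mkord.
by apply: eq_bigr => i _; rewrite -[c in iota 0 c]subn0 big_mkord.
Qed.

(** * The moment identities for a layered network *)

Section Moments.
Variables (R : realType) (N : net R) (x : vec R) (M : nat) (s : seq wcoord).
Hypothesis wf : wf_net N M s.
Variables m0 h0 : nat.
Hypotheses (hm0 : (h0 < m0 <= M)%N) (e0 : edge N m0 h0) (dM : (0 < dim N M)%N).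
Local Notation W := (weights R).
Local Notation dim := (dim N).
Local Notation edge := (edge N).
Local Notation key := (key N).
Local Notation pre := (pre N x).
Local Notation post := (post N x).
Local Notation tang := (tang N x m0 h0).
Local Notation none := (fun _ _ : nat => false).
Local Notation all := (fun _ _ : nat => true).
Local Notation vout := (vout N x m0 h0).
Local Notation jac := (jac N x M m0 h0).
Local Notation k := (key m0 h0).
Local Notation saux := (mcoords kaux (dim m0) (dim h0)).
Implicit Types (w : W).

Definition redout w : R := tang all w (w k) M 0.

Definition sqjac w : R := \sum_(i < dim m0) \sum_(j < dim h0) jac w i j ^+ 2.

Lemma jac_aux w w' i j : (forall c, c \notin saux -> weight_at w' c = weight_at w c) ->
  jac w' i j = jac w i j.
Proof.
move=> w'E.
have wkey m h : (h < m <= M)%N -> edge m h -> w' (key m h) = w (key m h).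
  move=> hm e; apply/funext => r; apply/funext => b.
  apply: (w'E (key m h, r, b)).
  by rewrite mem_mcoords/= (negbTE (wf_kaux wf hm e)).
have preE m : (m <= M)%N -> pre w' m = pre w m.
  move=> mM; apply: pre_local => m' h /andP[hm' m'm] e.
  by apply: wkey => //; rewrite hm' (leq_trans m'm).
apply: (tang_local (wf_dim wf)) => //.
- by rewrite /post preE//; case/andP: hm0 => /ltnW; exact: leq_trans.
- by move=> h r /andP[_ hM] _ _ _; rewrite preE// ltnW.
- by move=> m h /andP[_ mM] /andP[_ hm] e; rewrite wkey// hm.
Qed.

(** The coefficients do not read [kaux], so given the network weights this is a centred Gaussian
    linear form. *)
Lemma vout_aux w w' : (forall c, c \notin saux -> weight_at w' c = weight_at w c) ->
  vout none w' M 0 = \sum_(c <- saux) jac w c.1.2 c.2 * weight_at w' c.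
Proof.
move=> w'E; rewrite /vout (tang_linear _ wf)// big_mcoords pair_bigA/=.
by apply: eq_bigr => q _; rewrite mulrC -/(jac w' q.1 q.2) (jac_aux _ _ w'E).
Qed.

Local Notation s' := (s ++ saux).

Let us' : uniq s'.
Proof.
rewrite cat_uniq (wf_uniq wf) uniq_mcoords andbT/=; apply/hasPn => c.
rewrite mem_mcoords => /and3P[/eqP ck _ _]; apply/negP => cs.
by have := wf_mem_kaux wf cs; rewrite ck eqxx.
Qed.

Let ss' : {subset s <= s'}.
Proof. by move=> c cs; rewrite mem_cat cs. Qed.

Lemma gaussE_vout_sqr :
  gaussE s' (fun w => (vout none w M 0 ^+ 2)%:E) = gaussE s (fun w => (sqjac w)%:E).
Proof.
rewrite /gaussE gauss_iter_cat; apply: eq_gauss_iter => w.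
have := @gauss_iter_linear_sqr _ saux (fun c => jac w c.1.2 c.2) 0 w
  (uniq_mcoords _ _ _).
rewrite expr0n/= add0r big_mcoords => <-; apply: eq_gauss_iter_off => w' w'E.
by rewrite add0r (vout_aux w'E).
Qed.

Lemma gaussE_vout_exp4 :
  gaussE s' (fun w => (vout none w M 0 ^+ 4)%:E) =
  gaussE s (fun w => (3 * sqjac w ^+ 2)%:E).
Proof.
rewrite /gaussE gauss_iter_cat; apply: eq_gauss_iter => w.
have := @gauss_iter_linear_exp4 _ saux (fun c => jac w c.1.2 c.2) 0 w
  (uniq_mcoords _ _ _).
rewrite /= !expr0n/= mulr0 mul0r !add0r big_mcoords => <-.
by apply: eq_gauss_iter_off => w' w'E; rewrite add0r (vout_aux w'E).
Qed.

Definition swap_key (c : wcoord) : wcoord :=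
  (if c.1.1 == k then kaux else if c.1.1 == kaux then k else c.1.1, c.1.2, c.2).

Lemma swap_keyK : involutive swap_key.
Proof.
case=> -[k' i] j; rewrite /swap_key/=; congr (_, _, _).
have [->|k'k] := eqVneq k' k; first by rewrite eqxx; case: eqP.
by have [->|k'a] := eqVneq k' kaux; rewrite ?eqxx// (negbTE k'k) (negbTE k'a).
Qed.

Lemma relabel_swap w k' i j : k' != k -> k' != kaux -> relabel swap_key w k' i j = w k' i j.
Proof. by move=> k'k k'a; rewrite /relabel/= (negbTE k'k) (negbTE k'a). Qed.

Let key_neq m h : (h < m <= M)%N -> edge m h -> m != m0 -> key m h != k.
Proof.
move=> hm e; apply: contraNneq => kk.
by have [-> _] := wf_inj wf hm hm0 e e0 kk.
Qed.

(* The reduced network does not read the matrix [k] once [kaux] stands for it. *)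
Definition reduced_coords (c : wcoord) := (c.1.1 != k) && ((c.1.1 == kaux) ==> (c \in saux)).

Lemma vout_all_eq w w' (k1 k2 : wkey) :
  (forall m h, (h < m <= M)%N -> edge m h -> m != m0 -> w (key m h) = w' (key m h)) ->
  (forall i j, (i < dim m0)%N -> (j < dim h0)%N -> w k1 i j = w' k2 i j) ->
  tang all w (w k1) M 0 = tang all w' (w' k2) M 0.
Proof.
move=> wE kE; apply: (tang_local (wf_dim wf)) => //.
- rewrite /post; have -> // : pre w h0 = pre w' h0.
  have /andP[hm m0M] := hm0.
  apply: pre_local => m h /andP[hm' mh] e; have mm0 := leq_ltn_trans mh hm.
  by rewrite wE ?hm' ?(leq_trans (ltnW mm0))// ltn_eqF.
- by move=> m h /andP[mm mM] /andP[_ hm] e; rewrite wE ?hm ?mM// gtn_eqF.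
Qed.

Lemma vout_depends : depends reduced_coords (fun w => vout all w M 0).
Proof.
move=> w w' ww'; apply: vout_all_eq => [m h hm e mm|i j im jh].
  apply/funext => i; apply/funext => j; apply: ww'.
  by rewrite /reduced_coords/= key_neq// (negbTE (wf_kaux wf hm e)).
apply: ww'; rewrite /reduced_coords/= eq_sym (wf_kaux wf hm0 e0)/= mem_mcoords/=.
by rewrite im jh.
Qed.

(** With all gates exchanged the output reads [kaux] but no longer the matrix [k], so swapping the
    two names turns the expectation over [s'] into one over [s] alone. *)
Lemma gaussE_redout (F : R -> \bar R) : measurable_fun setT F ->
  (forall y, 0 <= F y)%E ->
  gaussE s' (fun w => F (vout all w M 0)) = gaussE s (fun w => F (redout w)).
Proof.
move=> mF F0.
have kk := wf_kaux wf hm0 e0.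
pose H w := F (vout all w M 0).
have HD : depends reduced_coords H by move=> w w' ww'; rewrite /H (vout_depends ww').
have mH : cmeas H.
  by apply: (cmeas_comp mF); apply: cmeas_tang => r b; exact: cmeas_at.
transitivity (gaussE s (H \o relabel swap_key)); last first.
  apply: eq_gauss_iter => w; rewrite /H/=; congr F.
  apply: vout_all_eq => [m h hm e mm|i j _ _].
    apply/funext => i; apply/funext => j.
    by rewrite relabel_swap ?(wf_kaux wf)// key_neq.
  by rewrite /relabel/= eq_sym (negbTE kk).
rewrite /gaussE gauss_iter_relabel; last exact: swap_keyK.
apply: (@perm_gauss_iter_depends _ _ _ reduced_coords H) => //.
- by rewrite map_inj_uniq ?(wf_uniq wf)//; exact: inv_inj swap_keyK.
- move=> c Dc; rewrite -[c in RHS]swap_keyK mem_map; last exact: inv_inj swap_keyK.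
  move: Dc; rewrite unfold_in /reduced_coords => /andP[ck ca].
  rewrite mem_cat; case: c ck ca => -[k' i] j /= k'k k'a.
  rewrite /swap_key/= (negbTE k'k).
  have [kE|k'n] := eqVneq k' kaux.
    move: k'a; rewrite kE eqxx/= => cs; rewrite cs orbT.
    move: cs; rewrite mem_mcoords => /and3P[_ im jh].
    by rewrite (wf_mem wf hm0 e0 im jh).
  by rewrite mem_mcoords/= (negbTE k'n) orbF.
- by move=> w; exact: F0.
Qed.

Lemma cmeas_jac i j : cmeas (fun w => jac w i j).
Proof.
apply: (@cmeas_tang _ N x m0 h0 _ (fun _ => delta R i j)) => r b.
exact: cmeas_cst.
Qed.

Lemma cmeas_sqjac : cmeas sqjac.
Proof.
apply: cmeas_sum => i; apply: cmeas_sum => j.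
by under [X in cmeas X]eq_fun do rewrite expr2; apply: cmeasM; exact: cmeas_jac.
Qed.

Lemma sqjac_ge0 w : 0 <= sqjac w.
Proof. by apply: sumr_ge0 => i _; apply: sumr_ge0 => j _; exact: sqr_ge0. Qed.

Theorem net_jacobian_moments :
  jacobian_moments s (fun w => pre w M 0) redout k (dim m0) (dim h0).
Proof.
have jE w : ~~ bad N x M w ->
    jac_sqnorm (fun w => pre w M 0) w k (dim m0) (dim h0) = sqjac w.
  by move=> gw; exact: (jac_sqnormE wf hm0 e0 gw dM).
have nbad : null s (bad N x M) by exact: (null_bad x wf (wf_uniq wf)).
have jac_ge0 w : 0 <= jac_sqnorm (fun w => pre w M 0) w k (dim m0) (dim h0).
  by apply: sumr_ge0 => i _; apply: sumr_ge0 => j _; exact: sqr_ge0.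
have red_none n : ~~ odd n -> gaussE s' (fun w => (vout none w M 0 ^+ n)%:E) =
    gaussE s (fun w => (redout w ^+ n)%:E).
  move=> n2; pose F (y : R) := (y ^+ n)%:E.
  have mF : measurable_fun setT F by apply/measurable_EFinP; exact: exprn_measurable.
  have F0 y : (0 <= F y)%E by rewrite lee_fin exprn_even_ge0.
  by rewrite (gaussE_none_all x wf hm0 e0 us' ss' dM mF F0) gaussE_redout.
(* The derivative is identified only off a null set; [eq_gaussE_null] asks measurability of the
   [sqjac] side alone. *)
have m2 : gaussE s (fun w => (jac_sqnorm (fun w => pre w M 0) w k (dim m0) (dim h0))%:E)
    = gaussE s (fun w => (sqjac w)%:E).
  apply: (eq_gaussE_null nbad).
  - by move=> w; rewrite lee_fin.
  - by move=> w; rewrite lee_fin sqjac_ge0.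
  - by apply: (cmeas_comp (f := EFin)) cmeas_sqjac.
  - by move=> w gw; rewrite jE.
have msq : cmeas (fun w => (sqjac w ^+ 2)%:E).
  apply: (cmeas_comp (f := fun y : R => (y ^+ 2)%:E)) cmeas_sqjac.
  by apply/measurable_EFinP; exact: exprn_measurable.
have m4 : gaussE s (fun w =>
      (jac_sqnorm (fun w => pre w M 0) w k (dim m0) (dim h0) ^+ 2)%:E)
    = gaussE s (fun w => (sqjac w ^+ 2)%:E).
  apply: (eq_gaussE_null nbad) => //.
  - by move=> w; rewrite lee_fin sqr_ge0.
  - by move=> w; rewrite lee_fin sqr_ge0.
  - by move=> w gw; rewrite jE.
(* The fourth moment identity is exact, and both inequalities are read off from it. *)
have E4 : gaussE s (fun w => (redout w ^+ 4)%:E) =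
    (3%:E * gaussE s (fun w => (sqjac w ^+ 2)%:E))%E.
  rewrite -red_none// gaussE_vout_exp4 /gaussE -gauss_iterZl// => w.
  by rewrite lee_fin sqr_ge0.
have X0 : (0 <= gaussE s (fun w => (sqjac w ^+ 2)%:E))%E.
  by apply: gauss_iter_ge0 => w; rewrite lee_fin sqr_ge0.
split; first by rewrite m2 -gaussE_vout_sqr red_none.
rewrite m4 E4; split.
  by rewrite muleA -EFinM mulVf ?mul1e// pnatr_eq0.
rewrite -{1}[gaussE s _]mul1e; apply: lee_wpmul2r => //.
by rewrite lee_fin ler1n.
Qed.

End Moments.

(** * DenseNets *)

Section Coordinates.

Lemma mem_all_coords mats (m : wcoord) i j : m \in mats -> (i < m.1.2)%N ->
  (j < m.2)%N -> (m.1.1, i, j) \in all_coords mats.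
Proof.
move=> mm im jm; apply/flattenP; exists (mcoords m.1.1 m.1.2 m.2).
  by apply/mapP; exists m.
by rewrite mem_mcoords/= eqxx im.
Qed.

Lemma all_coords_key mats c : c \in all_coords mats ->
  c.1.1 \in [seq m.1.1 | m <- mats].
Proof.
move=> /flattenP[t /mapP[m mm ->]]; rewrite mem_mcoords => /and3P[/eqP -> _ _].
by apply/mapP; exists m.
Qed.

Lemma uniq_all_coords mats : uniq [seq m.1.1 | m <- mats] -> uniq (all_coords mats).
Proof.
elim: mats => //= m mats IH /andP[mn um].
rewrite /all_coords/= cat_uniq uniq_mcoords IH// andbT /=.
apply/hasPn => c /all_coords_key ck; rewrite mem_mcoords.
by apply: contra mn => /and3P[/eqP <- _ _].
Qed.

Lemma uniq_keys (r : seq nat) (r' : nat -> seq nat) : uniq r -> (forall l, uniq (r' l)) ->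
  uniq (WIn :: [seq WMid l h | l <- r, h <- r' l] ++ [:: WOut]).
Proof.
move=> ur ur'; rewrite /= cat_uniq allpairs_uniq_dep//=.
- rewrite mem_cat !inE/= orbF andbT; apply/andP; split.
    by rewrite orbF; apply/negP => /flatten_mapP[l _ /mapP[]].
  by apply/negP => /flatten_mapP[l _ /mapP[]].
- by move=> [l h] [l' h'] _ _ /= [-> ->].
Qed.

End Coordinates.

(** * Matrices that no connection bypasses *)

Section Unreduced.
Variables (R : realType) (N : net R) (x : vec R) (m0 h0 M : nat).
Hypotheses (hm0 : (h0 < m0)%N) (e0 : edge N m0 h0).
Hypothesis edge0 : forall h, (h < m0)%N -> edge N m0 h -> h = h0.
Hypothesis sk0 : forall h, (h < m0)%N -> sk N m0 h = 0.
Hypothesis gt0 : forall m h, (m0 < m <= M)%N -> (h < m0)%N ->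
  ~~ edge N m h /\ sk N m h = 0.

(** If [key m0 h0] is the only way into layer [m0] and nothing jumps over that layer, removing the
    bypasses removes nothing. This covers the first and last projections. *)
Lemma tang_all_pre w m : (m0 <= m <= M)%N ->
  pre N x w m = tang N x m0 h0 (fun _ _ => true) w (w (key N m0 h0)) m.
Proof.
move: m; apply: tang_unique => [i|m mm].
  rewrite preE ?(leq_ltn_trans _ hm0)// /sumin big1 ?add0r; last first.
    by move=> h _; rewrite sk0// mul0r.
  rewrite (big_pred1 (Ordinal hm0))// => h /=.
  apply/idP/eqP => [e|->//]; apply: val_inj; exact: (edge0 (ltn_ord h) e).
have /andP[m0m _] := mm.
rewrite preE; last exact: leq_ltn_trans m0m.
apply/funext => i; rewrite /sumin; congr (_ + _).
  rewrite [RHS]big_mkcond/=; apply: eq_bigr => h _; case: leqP => // hm.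
  by have [_ ->] := gt0 mm hm; rewrite mul0r.
apply: eq_bigl => h /=; case: leqP => // hm.
by have [/negbTE -> _] := gt0 mm hm.
Qed.

End Unreduced.

Section DenseNet.
Variables (R : realType) (d L : nat) (nd : nat -> nat) (alpha : R) (x : vec R).
Local Notation W := (weights R).
Local Notation mats := (densenet_mats d L nd).
Implicit Types (w : W) (red : option (nat * nat)).

(* Layer [l.+1] holds y^l, and layer [L.+2] the output.                      *)
Definition dnet : net R := Net
  (fun m => if m == L.+2 then 1%N else if m is l.+1 then nd l else d)
  (fun m => (0 < m <= L)%N)
  (fun m h => if m == L.+2 then h == L.+1 else if m == 1%N then true else (0 < h)%N)
  (fun m h => if m == L.+2 then WOut else if m == 1%N then WIn else WMid m.-1 h.-1)
  (fun m h => if m == L.+2 then (Num.sqrt (nd L)%:R)^-1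
              else if m == 1%N then (Num.sqrt (nd 0)%:R)^-1
              else Num.sqrt (alpha / ((nd m.-2)%:R * (m.-1)%:R)))
  (fun _ _ => 0).

Lemma wf_dnet : wf_net dnet L.+2 (all_coords mats).
Proof.
have keysE : [seq m.1.1 | m <- mats] =
    WIn :: [seq WMid l h | l <- iota 1 L, h <- iota 0 l] ++ [:: WOut].
  by rewrite /densenet_mats /= map_cat map_allpairs.
split=> //=.
- rewrite uniq_all_coords// keysE uniq_keys ?iota_uniq// => l.
  exact: iota_uniq.
- move=> m h i j /andP[hm mL].
  have [mE|mn] := eqVneq m L.+2.
    move=> /eqP hE; rewrite hE eqn_leq ltnn andbF => i1 jn.
    by apply: (@mem_all_coords _ (WOut, 1%N, nd L)) => //; rewrite !mem_cat !mem_seq1 eqxx !orbT.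
  have {mn} mL' : (m <= L.+1)%N by rewrite -ltnS ltn_neqAle mn.
  have hL : (h == L.+2) = false by apply: ltn_eqF; rewrite (ltn_trans hm).
  rewrite hL; have [mE|mn] := eqVneq m 1%N.
    move: hm; rewrite mE ltnS leqn0 => /eqP -> _ im jn.
    by apply: (@mem_all_coords _ (WIn, nd 0, d)) => //; rewrite !mem_cat !mem_seq1 eqxx.
  move=> h_gt0; case: m hm mL' mn {mL} => // -[//|l] hm lL _.
  case: h h_gt0 hm hL => // h _ hl _ im jn.
  apply: (@mem_all_coords _ (WMid l.+1 h, nd l.+1, nd h)) => //.
  rewrite !mem_cat; apply/orP; right; apply/orP; left.
  apply/flatten_mapP; exists l.+1; first by rewrite mem_iota add1n.
  by apply/mapP; exists h; rewrite ?mem_iota.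
- move=> m h m' h' /andP[hm mL] /andP[hm' mL'].
  have [mE|mn] := eqVneq m L.+2; have [mE'|mn'] := eqVneq m' L.+2.
  + by move=> /eqP -> /eqP -> _; rewrite mE mE'.
  + by case: ifP.
  + by case: ifP.
  have [m1|m1] := eqVneq m 1%N; have [m1'|m1'] := eqVneq m' 1%N => //.
    by move: hm hm'; rewrite m1 m1' !ltnS !leqn0 => /eqP -> /eqP ->.
  move=> h0 h0' [mm hh]; split.
    by move: hm hm' mm; case: (m) => // ?; case: (m') => //= ? _ _ ->.
  by move: h0 h0' hh; case: (h) => // ?; case: (h') => //= ? _ _ ->.
- move=> m h /andP[hm _]; have [//|mn] := eqVneq m L.+2.
  have [//|m1 _] := eqVneq m 1%N.
  by apply/eqP => -[mE _]; move: hm m1 mE; case: m {mn} => // -[].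
- move=> c /all_coords_key; rewrite keysE in_cons mem_cat => /or3P[/eqP ->//| |].
    move=> /flatten_mapP[l + /mapP[h _ ->]]; rewrite mem_iota => /andP[l0 _].
    by apply/eqP => -[lE _]; rewrite lE in l0.
  by rewrite inE => /eqP ->.
- by move=> m h _; rewrite eqxx.
- by move=> m h _; rewrite eqxx.
- by move=> m h h' _ _; rewrite eqxx.
Qed.

Definition dy red w l : vec R := nth (fun _ => 0) (densenet_ys d nd alpha red x w l) l.

Lemma size_densenet_ys red w l : size (densenet_ys d nd alpha red x w l) = l.+1.
Proof. by elim: l => //= l IH; rewrite size_rcons IH. Qed.

Lemma nth_densenet_ys red w l h : (h <= l)%N ->
  nth (fun _ => 0) (densenet_ys d nd alpha red x w l) h = dy red w h.
Proof.
elim: l => [|l IH]; first by rewrite leqn0 => /eqP ->.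
rewrite leq_eqVlt => /predU1P[->//|hl].
by rewrite /= nth_rcons size_densenet_ys hl IH.
Qed.

Lemma dyS red w l : dy red w l.+1 = fun i =>
  Num.sqrt (alpha / ((nd l)%:R * l.+1%:R)) *
  \sum_(h < l.+1 | dkeep red l.+1 h) lin w (WMid l.+1 h) (nd h) (q_of (dy red w h)) i.
Proof.
rewrite /dy /= nth_rcons size_densenet_ys ltnn eqxx; apply/funext => i.
by congr (_ * _); apply: eq_bigr => h _; rewrite nth_densenet_ys// -ltnS.
Qed.

Definition dz red w m : vec R :=
  if m == L.+2 then
    fun i => (Num.sqrt (nd L)%:R)^-1 * \sum_(j < nd L) w WOut i j * dy red w L j
  else if m is l.+1 then dy red w l else x.

Definition dact red w h : vec R :=
  fun i => actd (rl dnet h) (dz red w h i) (dz red w h i).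

Lemma dactS red w h : (h < L)%N -> dact red w h.+1 = q_of (dy red w h).
Proof.
move=> hL; apply/funext => i; rewrite /dact /= hL /q_of -actd_relu.
by rewrite /dz ltn_eqF// ltnS ltnW// ltnS.
Qed.

Lemma dactL red w : dact red w L.+1 = dy red w L.
Proof. by apply/funext => i; rewrite /dact /= ltnn /dz ltn_eqF. Qed.

Lemma dsumin_in w a i : sumin dnet w 1 predT a i =
  (Num.sqrt (nd 0)%:R)^-1 * \sum_(j < d) w WIn i j * a 0%N j.
Proof. by rewrite /sumin big1 ?add0r ?big_ord1//= => h _; rewrite mul0r. Qed.

Lemma dsumin_mid w keep a l i : (l < L)%N -> sumin dnet w l.+2 keep a i =
  Num.sqrt (alpha / ((nd l)%:R * l.+1%:R)) *
  \sum_(h < l.+1 | keep h.+1) \sum_(j < nd h) w (WMid l.+1 h) i j * a h.+1 j.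
Proof.
move=> lL; rewrite /sumin big1 ?add0r => [|h _]; last by rewrite mul0r.
rewrite big_mkcond big_ord_recl /= eqSS ltn_eqF// andbF add0r mulr_sumr.
rewrite [RHS]big_mkcond; apply: eq_bigr => h _ /=.
rewrite andbT eqSS ltn_eqF//; last by rewrite (ltn_trans (ltn_ord h)).
Qed.

Lemma dsumin_out w (keep : pred nat) a i : keep L.+1 -> sumin dnet w L.+2 keep a i =
  (Num.sqrt (nd L)%:R)^-1 * \sum_(j < nd L) w WOut i j * a L.+1 j.
Proof.
move=> kL; rewrite /sumin big1 ?add0r => [|h _]; last by rewrite mul0r.
rewrite (big_pred1 ord_max) /= ?eqxx ?ltn_eqF// => h.
apply/andP/eqP => [[_ /eqP hE]|->]; [exact: val_inj|by rewrite eqxx].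
Qed.

(** [keep] is free in order to serve three cases: all layers in the full network, a single source at
    the reduced layer, and [leq lk.+1] above it. *)
Lemma dz_mid red w l (keep : pred nat) : (l < L)%N ->
  (forall h, (h <= l)%N -> keep h.+1 = dkeep red l.+1 h) ->
  dz red w l.+2 = sumin dnet w l.+2 keep (dact red w).
Proof.
move=> lL kE; apply/funext => i; rewrite dsumin_mid// /dz eqSS ltn_eqF// dyS.
congr (_ * _); apply: eq_big => h; first by rewrite kE// -ltnS.
move=> _; apply: eq_bigr => j _; rewrite dactS//.
by rewrite (leq_trans (ltn_ord h)).
Qed.

Lemma dz_out red w (keep : pred nat) : keep L.+1 ->
  dz red w L.+2 = sumin dnet w L.+2 keep (dact red w).
Proof. by move=> kL; apply/funext => i; rewrite dsumin_out// dactL /dz eqxx. Qed.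

Lemma dz_pre w m : (m <= L.+2)%N -> dz None w m = pre dnet x w m.
Proof.
move: m; apply: pre_unique => // -[//|[|l]] /=.
  by move=> _; apply/funext => i; rewrite dsumin_in /dz/=.
rewrite ltnS leq_eqVlt => /predU1P[[->]|lL]; first exact: dz_out.
exact: dz_mid.
Qed.

Lemma densenet_pre w : densenet d L nd alpha x w = pre dnet x w L.+2 0.
Proof. by rewrite -dz_pre// /dz eqxx. Qed.

Lemma dy_red_lt lk hk w l : (l < lk)%N -> dy (Some (lk, hk)) w l = dy None w l.
Proof.
elim/ltn_ind: l => -[//|l] IH llk; rewrite !dyS; apply/funext => i.
congr (_ * _); apply: eq_big => [h|h _]; first by rewrite /= llk.
by rewrite IH// (ltn_trans (ltn_ord h)).
Qed.

(** Indices shift by one, $y^l$ being layer [l.+1]. The sum over $h \ge l_k$ in the reduced DenseNet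
    is the restriction [leq m0] of [tang], and below [lk] nothing was removed ([dy_red_lt]). *)
Lemma densenet_red_tang lk hk w : (hk < lk <= L)%N ->
  densenet_red d L nd alpha (WMid lk hk) x w =
  tang dnet x lk.+1 hk.+1 (fun _ _ => true) w (w (WMid lk hk)) L.+2 0.
Proof.
move=> /andP[hl lL]; set red := Some (lk, hk).
rewrite -(@tang_unique _ _ _ _ _ _ _ _ L.+2 (dz red w)).
- by rewrite /dz eqxx.
- case: lk hl lL @red => // l hl lL red i.
  rewrite (@dz_mid red w l (fun h => h == hk.+1))//; last first.
    by move=> h hl'; rewrite /dkeep/= ltnn eqxx eqSS.
  rewrite dsumin_mid// (big_pred1 (Ordinal hl)) /=; last by move=> h; rewrite eqSS.
  have hkL : (hk < L)%N := leq_trans hl lL.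
  have hkF : (hk == L.+1) = false by rewrite ltn_eqF// ltnS ltnW.
  rewrite !eqSS hkF (ltn_eqF lL); congr (_ * _); apply: eq_bigr => j _; congr (_ * _).
  rewrite dactS// /post -dz_pre; last by rewrite ltnS (leq_trans (ltnW hkL)).
  rewrite -/(dact None w hk.+1 j) dactS//.
  by rewrite dy_red_lt.
- move=> [//|[//|l]] /andP[ll]; rewrite ltnS leq_eqVlt => /predU1P[[->]|lL'].
    by rewrite (@dz_out red w (leq lk.+1)).
  rewrite (@dz_mid red w l (leq lk.+1))// => h hl'.
  by have lk_lt : (lk < l.+1)%N := ll; rewrite /dkeep/= [in RHS]ltnNge (ltnW lk_lt) gtn_eqF.
- by rewrite leqnn andbT ltnS (leq_trans lL).
Qed.

Theorem densenet_moments (m : wcoord) : m \in mats ->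
  jacobian_moments (all_coords mats) (densenet d L nd alpha x)
    (densenet_red d L nd alpha m.1.1 x) m.1.1 m.1.2 m.2.
Proof.
have -> : densenet d L nd alpha x = fun w => pre dnet x w L.+2 0.
  by apply/funext => w; exact: densenet_pre.
have dM : (0 < dim dnet L.+2)%N by rewrite /= eqxx.
rewrite !mem_cat => /or3P[| |]; rewrite ?inE.
- move=> /eqP -> /=.
  have := @net_jacobian_moments _ _ x _ _ wf_dnet 1 0 isT isT dM.
  rewrite /=; congr jacobian_moments; apply/funext => w.
  rewrite /redout -[X in w X]/(key dnet 1 0) -(@tang_all_pre _ _ _ _ _ L.+2)//.
  + by rewrite -densenet_pre.
  + by move=> h; rewrite ltnS leqn0 => /eqP.
  + move=> m' h /andP[m1 _]; rewrite ltnS leqn0 => /eqP -> /=.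
    by rewrite [m' == 1%N]gtn_eqF//; case: ifP.
  + by rewrite leqnn.
- move=> /flatten_mapP[l + /mapP[h + ->]]; rewrite !mem_iota /= add1n ltnS => /andP[l0 lL] hl.
  have hm : (h.+1 < l.+1 <= L.+2)%N by rewrite !ltnS hl (leq_trans lL).
  have e : edge dnet l.+1 h.+1 by rewrite /= !eqSS ltn_eqF// gtn_eqF.
  have := @net_jacobian_moments _ _ x _ _ wf_dnet _ _ hm e dM.
  have -> : key dnet l.+1 h.+1 = WMid l h by rewrite /= !eqSS ltn_eqF// gtn_eqF.
  have -> : dim dnet l.+1 = nd l by rewrite /= eqSS ltn_eqF.
  have -> : dim dnet h.+1 = nd h by rewrite /= eqSS ltn_eqF// (ltn_trans hl).
  congr jacobian_moments; apply/funext => w.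
  rewrite [RHS](@densenet_red_tang l h)// ?hl// /redout.
  by rewrite /= !eqSS ltn_eqF// gtn_eqF.
- move=> /eqP -> /=.
  have hm : (L.+1 < L.+2 <= L.+2)%N by rewrite !leqnn.
  have e : edge dnet L.+2 L.+1 by rewrite /= !eqxx.
  have := @net_jacobian_moments _ _ x _ _ wf_dnet _ _ hm e dM.
  have -> : key dnet L.+2 L.+1 = WOut by rewrite /= eqxx.
  have -> : dim dnet L.+2 = 1%N by rewrite /= eqxx.
  have -> : dim dnet L.+1 = nd L by rewrite /= ltn_eqF.
  congr jacobian_moments; apply/funext => w.
  rewrite /redout -(@tang_all_pre _ _ _ _ _ L.+2)//.
  + by rewrite -densenet_pre.
  + by move=> h _ /=; rewrite eqxx => /eqP.
  + by move=> m' h /andP[m1 m2]; move: (leq_trans m1 m2); rewrite ltnn.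
Qed.

End DenseNet.

(** * ResNets *)

Section ResNet.
Variables (R : realType) (d n L mb : nat) (nb : nat -> nat -> nat).
Variables (alpha : nat -> R) (x : vec R).
Hypothesis mb_gt0 : (0 < mb)%N.
Local Notation W := (weights R).
Local Notation mats := (resnet_mats d n L mb nb).
Local Notation rdim := (rdim n mb nb).
Local Notation M := (L * mb).+2.
Local Notation Y := (resnet_y d n mb nb alpha).
Implicit Types (w : W) (red : option nat) (j l h : nat).

Lemma divmodS j : (j.+1 %/ mb, j.+1 %% mb)%N =
  if (j %% mb).+1 == mb then ((j %/ mb).+1, 0%N) else (j %/ mb, (j %% mb).+1)%N.
Proof.
rewrite {1 2}(divn_eq j mb) -addnS; case: eqP => [->|/eqP jn].
  by rewrite -mulSnr mulnK// modnMl.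
have jl : ((j %% mb).+1 < mb)%N by rewrite ltn_neqAle jn ltn_mod.
by rewrite divnMDl// (divn_small jl) addn0 modnMDl (modn_small jl).
Qed.

(** At the end of a block, one side is the width of the next block input and the other that of the
    branch output; both are [n]. *)
Lemma rdimS j : rdim (j.+1 %/ mb).+1 (j.+1 %% mb) = rdim (j %/ mb).+1 (j %% mb).+1.
Proof.
by have := divmodS j; case: eqP => [jE [-> ->]|_ [-> ->]//]; rewrite /Defs.rdim jE !eqxx orbT.
Qed.

(* Layer [(l * mb + h).+1] holds the value y^{l,h} of the branch leaving y^l  *)
(* (y^l itself for [h = 0]), and layer [M] the output.                       *)
Definition rnet : net R := Net
  (fun m => if m == M then 1%N
            else if m is j.+1 then rdim (j %/ mb).+1 (j %% mb) else d)
  (fun m => if m is j.+1 then (j %% mb != 0)%N else false)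
  (fun m h => h.+1 == m)
  (fun m h => if m == M then WOut
              else if m is j.+2 then WMid (j %/ mb).+1 (j %% mb).+1 else WIn)
  (fun m h => if m == M then (Num.sqrt n%:R)^-1
              else if m is j.+2 then
                (if (j %% mb).+1 == mb then Num.sqrt (alpha (j %/ mb).+1) else 1)
                * (Num.sqrt (rdim (j %/ mb).+1 (j %% mb))%:R)^-1
              else (Num.sqrt n%:R)^-1)
  (fun m h => if m == M then 0
              else if m is j.+2 then (((j %% mb).+1 == mb) && (h + mb == m)%N)%:R
              else 0).

Lemma dim_in : dim rnet 1 = n.
Proof. by rewrite /= div0n mod0n. Qed.

Lemma dim_mid j : (j <= L * mb)%N -> dim rnet j.+1 = rdim (j %/ mb).+1 (j %% mb).
Proof. by move=> jL; rewrite /= eqSS ltn_eqF. Qed.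

Lemma dim_last : dim rnet (L * mb).+1 = n.
Proof. by rewrite dim_mid// modnMl /Defs.rdim eqxx. Qed.

Lemma key_mid j h : (j < L * mb)%N ->
  key rnet j.+2 h = WMid (j %/ mb).+1 (j %% mb).+1.
Proof. by move=> jL; rewrite /= !eqSS ltn_eqF. Qed.

Lemma sk_source m h : sk rnet m h != 0 ->
  exists2 j, m = j.+2 & [/\ (j < L * mb)%N || (L * mb < j)%N, (j %% mb).+1 = mb &
    h = (j %/ mb * mb).+1].
Proof.
rewrite /=; have [mE|mM] := eqVneq m M; first by rewrite eqxx.
case: m mM => [|[|j]] mM; rewrite ?eqxx//.
have [jE|_] := eqVneq (j %% mb).+1 mb; last by rewrite eqxx.
have [hE _|_] := eqVneq (h + mb)%N j.+2; last by rewrite eqxx.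
exists j => //; split=> //; first by rewrite -neq_ltn.
by move: (divn_eq j mb) hE jE; move: (j %/ mb * mb)%N (j %% mb)%N => q r; lia.
Qed.

Lemma wf_rnet : wf_net rnet M (all_coords mats).
Proof.
have keysE : [seq m.1.1 | m <- mats] =
    WIn :: [seq WMid l h | l <- iota 1 L, h <- iota 1 mb] ++ [:: WOut].
  by rewrite /resnet_mats /= map_cat map_allpairs.
split.
- by rewrite uniq_all_coords// keysE (uniq_keys (r' := fun=> iota 1 mb)) ?iota_uniq//.
- move=> m h i j /andP[hm mM] /eqP mE; subst m.
  move: mM; rewrite leq_eqVlt => /predU1P[[hE]|].
    rewrite hE dim_last [dim _ _]/= [key _ _ _]/= eqxx => i1 jn.
    apply: (@mem_all_coords _ (WOut, 1%N, n)) => //.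
    by rewrite !mem_cat !mem_seq1 eqxx !orbT.
  rewrite ltnS; case: h hm => [_ _|h _ hL].
    rewrite dim_in => im jn.
    apply: (@mem_all_coords _ (WIn, n, d)) => //.
    by rewrite !mem_cat !mem_seq1 eqxx.
  rewrite key_mid// !dim_mid//; last exact: ltnW.
  rewrite rdimS => im jn.
  apply: (@mem_all_coords _ (WMid (h %/ mb).+1 (h %% mb).+1,
    rdim (h %/ mb).+1 (h %% mb).+1, rdim (h %/ mb).+1 (h %% mb).+1.-1)) => //.
  rewrite !mem_cat; apply/orP; right; apply/orP; left.
  apply/flatten_mapP; exists (h %/ mb).+1.
    by rewrite mem_iota add1n !ltnS ltn_divLR.
  by apply/mapP; exists (h %% mb).+1; rewrite ?mem_iota ?add1n ?ltnS ?ltn_mod.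
- move=> m h m' h' /andP[_ mM] /andP[_ mM'] /eqP mE /eqP mE'; subst m m'.
  suff hh : key rnet h.+1 h = key rnet h'.+1 h' -> h = h' by move=> /hh ->.
  move: mM mM'; rewrite !ltnS leq_eqVlt => /predU1P[->|hL];
    rewrite leq_eqVlt => /predU1P[->|hL'] //.
  + by rewrite [key _ _ _]/= eqxx; case: h' hL' => // h' hL'; rewrite key_mid.
  + by rewrite [in RHS]/= eqxx; case: h hL => // h hL; rewrite key_mid.
  case: h hL => [|h] hL; case: h' hL' => [|h'] hL'; rewrite ?key_mid//.
  by move=> [hd hm]; rewrite (divn_eq h mb) hd hm -divn_eq.
- move=> m h /andP[_ mM] /eqP mE; subst m; move: mM; rewrite ltnS leq_eqVlt.
  move=> /predU1P[->|hL]; first by rewrite /= eqxx.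
  by case: h hL => // h hL; rewrite key_mid.
- move=> c /all_coords_key; rewrite keysE in_cons mem_cat => /or3P[/eqP ->//| |].
    move=> /flatten_mapP[l + /mapP[h _ ->]]; rewrite mem_iota => /andP[l0 _].
    by apply/eqP => -[lE _]; rewrite lE in l0.
  by rewrite inE => /eqP ->.
- move=> m h /andP[hm mM] /sk_source[j mE [jL jmb hE]]; subst m h.
  have {}jL : (j < L * mb)%N by case/orP: jL => // jL; move: mM; rewrite !ltnS leqNgt jL.
  rewrite !dim_mid//; last by rewrite (leq_trans _ (ltnW jL))// leq_trunc_div.
  by rewrite rdimS modnMl /Defs.rdim jmb eqxx orbT.
- move=> m h /andP[hm mM] /sk_source[j mE [jL jmb hE]]; subst m h.
  rewrite /= modnMl eqxx andbT.
  by have := divmodS j; rewrite jmb eqxx => -[_ ->].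
- by move=> m h h' _ _ /sk_source[j -> [_ _ ->]] /sk_source[j' [->] [_ _ ->]].
Qed.

Definition rv red w j : vec R :=
  rbranch n mb nb w (j %/ mb).+1 (j %% mb) (Y red x w (j %/ mb)).

Lemma rbranchS w l h v i : rbranch n mb nb w l h.+1 v i =
  (Num.sqrt (rdim l h)%:R)^-1 * \sum_(b < rdim l h)
    w (WMid l h.+1) i b
      * actd (h != 0)%N (rbranch n mb nb w l h v b) (rbranch n mb nb w l h v b).
Proof.
case: h => [|h]; first by rewrite /= /scalev /lin /Defs.rdim eqxx.
rewrite [LHS]/= /scalev /lin; congr (_ * _); apply: eq_bigr => b _; congr (_ * _).
by rewrite actd_relu.
Qed.

(** The last branch step and the residual sum are merged: the successor of $h = m_b - 1$ is $y^l$
    itself, so $y^{l-1,m_b}$ has no layer of its own. *)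
Lemma rvS red w j i : rv red w j.+1 i =
  (if ((j %% mb).+1 == mb) && (red != Some (j %/ mb).+1)
   then Y red x w (j %/ mb) i else 0) +
  (if (j %% mb).+1 == mb then Num.sqrt (alpha (j %/ mb).+1) else 1)
  * (Num.sqrt (rdim (j %/ mb).+1 (j %% mb))%:R)^-1
  * \sum_(b < rdim (j %/ mb).+1 (j %% mb)) w (WMid (j %/ mb).+1 (j %% mb).+1) i b
     * actd (j %% mb != 0)%N (rv red w j b) (rv red w j b).
Proof.
rewrite {1}/rv; have := divmodS j; case: eqP => [jmb|_] [-> ->].
  rewrite /=.
  have -> : rbranch n mb nb w (j %/ mb).+1 mb (Y red x w (j %/ mb)) i =
      rbranch n mb nb w (j %/ mb).+1 (j %% mb).+1 (Y red x w (j %/ mb)) i.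
    by rewrite jmb.
  by rewrite rbranchS -mulrA; congr (_ + _); case: eqP.
by rewrite rbranchS [in RHS]/= add0r mul1r.
Qed.

Definition rz red w m : vec R :=
  if m == M then
    fun i => (Num.sqrt n%:R)^-1 * \sum_(j < n) w WOut i j * Y red x w L j
  else if m is j.+1 then rv red w j else x.

Definition ract red w h : vec R :=
  fun i => actd (rl rnet h) (rz red w h i) (rz red w h i).

Lemma rz_mid_rv red w j : (j <= L * mb)%N -> rz red w j.+1 = rv red w j.
Proof. by move=> jL; rewrite /rz eqSS ltn_eqF. Qed.

Lemma rv_skip red w l : rv red w (l * mb) = Y red x w l.
Proof. by rewrite /rv mulnK// modnMl. Qed.

Lemma ract_skip red w l : (l <= L)%N -> ract red w (l * mb).+1 = Y red x w l.
Proof.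
move=> lL; apply/funext => i.
by rewrite /ract /= modnMl /= rz_mid_rv ?leq_mul2r ?lL ?orbT// rv_skip.
Qed.

Lemma rsumin_in w a i : sumin rnet w 1 predT a i =
  (Num.sqrt n%:R)^-1 * \sum_(b < d) w WIn i b * a 0%N b.
Proof.
rewrite /sumin big1 ?add0r => [|h _]; last by rewrite /= mul0r.
by rewrite big_mkcond big_ord1.
Qed.

Lemma rsumin_mid w (keep : pred nat) a j i : (j < L * mb)%N -> keep j.+1 ->
  sumin rnet w j.+2 keep a i =
  (if ((j %% mb).+1 == mb) && keep (j %/ mb * mb).+1
   then a (j %/ mb * mb).+1 i else 0) +
  cf rnet j.+2 j.+1 * \sum_(b < rdim (j %/ mb).+1 (j %% mb))
    w (WMid (j %/ mb).+1 (j %% mb).+1) i b * a j.+1 b.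
Proof.
move=> jL kj; rewrite /sumin; congr (_ + _); last first.
  rewrite (big_pred1 ord_max); last first.
    move=> h; rewrite [edge _ _ _]/= eqSS.
    by apply/andP/eqP => [[_ /eqP hE]|->]; [exact: val_inj|].
  by rewrite key_mid// dim_mid// ltnW.
have srcj : ((j %/ mb * mb).+1 < j.+2)%N by rewrite !ltnS leq_trunc_div.
have [/andP[/eqP jmb ks]|nks] := boolP (_ && _).
  have sk1 : sk rnet j.+2 (j %/ mb * mb).+1 = 1.
    rewrite -[LHS]/(if j.+2 == M then 0 else
      (((j %% mb).+1 == mb) && ((j %/ mb * mb).+1 + mb == j.+2)%N)%:R).
    have -> : (j.+2 == M) = false by rewrite !eqSS ltn_eqF.
    rewrite jmb eqxx andTb; have -> // : ((j %/ mb * mb).+1 + mb == j.+2)%N.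
    apply/eqP; move: (divn_eq j mb) jmb.
    by move: (j %/ mb * mb)%N (j %% mb)%N => q r; lia.
  rewrite (bigD1 (Ordinal srcj))// [X in X * _]sk1 mul1r big1; first exact: addr0.
  move=> h /andP[_ hn]; have [->|] := eqVneq (sk rnet j.+2 h) 0; first by rewrite mul0r.
  move=> /sk_source[j' [jj] [_ _ hE]]; case/eqP: hn; apply: val_inj.
  by rewrite /= hE jj.
rewrite big1// => h kh; have [->|] := eqVneq (sk rnet j.+2 h) 0; first by rewrite mul0r.
move=> /sk_source[j' [jj] [_ jmb hE]]; case/negP: nks.
by rewrite jj jmb eqxx -hE.
Qed.

Lemma rsumin_out w (keep : pred nat) a i : keep (L * mb).+1 ->
  sumin rnet w M keep a i =
  (Num.sqrt n%:R)^-1 * \sum_(b < n) w WOut i b * a (L * mb).+1 b.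
Proof.
move=> kL; rewrite /sumin big1 ?add0r => [|h _]; last by rewrite /= eqxx mul0r.
rewrite (big_pred1 ord_max); last first.
  move=> h; rewrite [edge _ _ _]/= eqSS.
  by apply/andP/eqP => [[_ /eqP hE]|->]; [exact: val_inj|].
by rewrite dim_last /= eqxx.
Qed.

Lemma rz_mid red w j (keep : pred nat) : (j < L * mb)%N -> keep j.+1 ->
  ((j %% mb).+1 = mb -> keep (j %/ mb * mb).+1 = (red != Some (j %/ mb).+1)) ->
  rz red w j.+2 = sumin rnet w j.+2 keep (ract red w).
Proof.
move=> jL kj ks; apply/funext => i; rewrite rsumin_mid// rz_mid_rv// rvS.
congr (_ + _).
  case: eqP => //= jmb; rewrite ks//; case: ifP => // _; rewrite ract_skip//.
  by rewrite -ltnS ltnW// ltnS ltn_divLR.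
rewrite /= !eqSS (ltn_eqF jL); congr (_ * _); apply: eq_bigr => b _; congr (_ * _).
by rewrite /ract rz_mid_rv// ltnW.
Qed.

Lemma rz_out red w (keep : pred nat) : keep (L * mb).+1 ->
  rz red w M = sumin rnet w M keep (ract red w).
Proof. by move=> kL; apply/funext => i; rewrite rsumin_out// ract_skip// /rz eqxx. Qed.

Lemma rz_pre w m : (m <= M)%N -> rz None w m = pre rnet x w m.
Proof.
move: m; apply: pre_unique => // -[//|[|j]] /=.
  by move=> _; apply/funext => i; rewrite rsumin_in rz_mid_rv// /rv div0n mod0n.
rewrite ltnS leq_eqVlt => /predU1P[[->]|jL]; first exact: rz_out.
exact: rz_mid.
Qed.

Lemma resnet_pre w : resnet d n L mb nb alpha x w = pre rnet x w M 0.
Proof. by rewrite -rz_pre// /rz eqxx. Qed.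

Lemma resnet_y_red_lt lk w l : (l < lk)%N -> Y (Some lk) x w l = Y None x w l.
Proof.
elim: l => //= l IH ll; rewrite IH; last exact: ltnW.
apply/funext => i; congr (_ + _); case: eqP => // -[lE].
by rewrite lE ltnn in ll.
Qed.

Lemma resnet_red_tang j0 w : (j0 < L * mb)%N ->
  resnet_red d n L mb nb alpha (WMid (j0 %/ mb).+1 (j0 %% mb).+1) x w =
  tang rnet x j0.+2 j0.+1 (fun _ _ => true) w
    (w (WMid (j0 %/ mb).+1 (j0 %% mb).+1)) M 0.
Proof.
move=> j0L; set red := Some (j0 %/ mb).+1.
rewrite -(@tang_unique _ _ _ _ _ _ _ _ M (rz red w)).
- by rewrite /rz eqxx.
- move=> i; rewrite rz_mid_rv// rvS eqxx andbF add0r dim_mid; last exact: ltnW.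
  rewrite [cf _ _ _]/= !eqSS (ltn_eqF j0L); congr (_ * _); apply: eq_bigr => b _.
  congr (_ * _); rewrite /post -rz_pre; last by rewrite ltnS (leq_trans (ltnW j0L)).
  rewrite rz_mid_rv; last exact: ltnW.
  by rewrite /rv resnet_y_red_lt.
- move=> [//|[//|j]] /andP[jj]; rewrite ltnS leq_eqVlt => /predU1P[[->]|jL].
    by rewrite (@rz_out red w (leq j0.+2)).
  have {}jj : (j0 < j)%N by [].
  rewrite (@rz_mid red w j (leq j0.+2))// => _.
  (* The skip that ends block $q = j / m_b$ (counted from 0) starts at layer $q m_b + 1$, which is
     at least [j0.+2] exactly when $q > j_0 / m_b$: among the layers above, only the block of the
     chosen matrix loses its identity term. *)
  rewrite !ltnS -ltn_divLR// /red; have := leq_div2r mb (ltnW jj).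
  rewrite leq_eqVlt => /predU1P[->|lt]; first by rewrite ltnn eqxx.
  by rewrite lt; apply/esym/eqP => -[lE]; rewrite lE ltnn in lt.
- by rewrite leqnn andbT !ltnS ltnW.
Qed.

Theorem resnet_moments (m : wcoord) : m \in mats ->
  jacobian_moments (all_coords mats) (resnet d n L mb nb alpha x)
    (resnet_red d n L mb nb alpha m.1.1 x) m.1.1 m.1.2 m.2.
Proof.
have -> : resnet d n L mb nb alpha x = fun w => pre rnet x w M 0.
  by apply/funext => w; exact: resnet_pre.
have dM : (0 < dim rnet M)%N by rewrite /= eqxx.
rewrite !mem_cat => /or3P[| |]; rewrite ?inE.
- move=> /eqP ->.
  have := @net_jacobian_moments _ _ x _ _ wf_rnet 1 0 isT isT dM.
  rewrite dim_in; congr jacobian_moments; apply/funext => w.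
  rewrite /redout -(@tang_all_pre _ _ _ _ _ M)//.
  + by rewrite -resnet_pre.
  + by move=> h; rewrite ltnS leqn0 => /eqP.
  + move=> m' h /andP[m1 _]; rewrite ltnS leqn0 => /eqP ->; split.
      by rewrite /= ltn_eqF.
    by apply/eqP/negPn/negP => /sk_source[j _ [_ _]].
  + by rewrite leqnn.
- move=> /flatten_mapP[l + /mapP[h + ->]]; rewrite !mem_iota !add1n !ltnS.
  move=> /andP[l0 lL] /andP[h0 hmb].
  case: l l0 lL => // l _ lL; case: h h0 hmb => // h _ hmb.
  (* Both indices have been lowered by one: the matrix is [WMid l.+1 h.+1], leading from layer
     [j0.+1] to layer [j0.+2]. *)
  pose j0 := (l * mb + h)%N.
  have jd : (j0 %/ mb = l)%N by rewrite /j0 divnMDl// divn_small// addn0.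
  have jm : (j0 %% mb = h)%N by rewrite /j0 modnMDl modn_small.
  have j0L : (j0 < L * mb)%N by rewrite -ltn_divLR// jd.
  have hm : (j0.+1 < j0.+2 <= M)%N by rewrite ltnSn !ltnS ltnW.
  have e : edge rnet j0.+2 j0.+1 by rewrite /= eqxx.
  have := @net_jacobian_moments _ _ x _ _ wf_rnet _ _ hm e dM.
  rewrite key_mid// !dim_mid//; last exact: ltnW.
  rewrite rdimS jd jm; congr jacobian_moments; apply/funext => w.
  rewrite -[LHS]/(tang rnet x j0.+2 j0.+1 _ w (w (key rnet j0.+2 j0.+1)) M 0).
  by rewrite key_mid// -(resnet_red_tang _ j0L) jd jm.
- move=> /eqP ->.
  have hm : ((L * mb).+1 < M <= M)%N by rewrite !leqnn.
  have e : edge rnet M (L * mb).+1 by rewrite /= eqxx.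
  have := @net_jacobian_moments _ _ x _ _ wf_rnet _ _ hm e dM.
  rewrite dim_last.
  have -> : dim rnet M = 1%N by rewrite /= eqxx.
  have -> : key rnet M (L * mb).+1 = WOut by rewrite /= eqxx.
  congr jacobian_moments; apply/funext => w.
  rewrite /redout -(@tang_all_pre _ _ _ _ _ M)//.
  + by rewrite -resnet_pre.
  + by move=> h _ /= /eqP[].
  + by move=> h _; rewrite /= eqxx.
  + by move=> m' h /andP[m1 m2]; move: (leq_trans m1 m2); rewrite ltnn.
Qed.

End ResNet.

Local Close Scope classical_set_scope.
Unset Implicit Arguments.

Theorem theorem2 (R : realType) :
  (* ResNet *)
  (forall (d n L mb : nat) (nb : nat -> nat -> nat) (alpha : nat -> R) (x : vec R),
     (0 < n)%N -> (0 < mb)%N ->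
     (forall l h, (1 <= l <= L)%N -> (0 < h < mb)%N -> (0 < nb l h)%N) ->
     (forall l, (1 <= l <= L)%N -> 0 < alpha l) ->
     \sum_(j < d) x j ^+ 2 = 1 ->
     forall m, m \in resnet_mats d n L mb nb ->
       jacobian_moments (all_coords (resnet_mats d n L mb nb))
         (resnet d n L mb nb alpha x)
         (resnet_red d n L mb nb alpha m.1.1 x) m.1.1 m.1.2 m.2)
  /\
  (* DenseNet *)
  (forall (d L : nat) (nd : nat -> nat) (alpha : R) (x : vec R),
     (forall l, (l <= L)%N -> (0 < nd l)%N) ->
     0 < alpha ->
     \sum_(j < d) x j ^+ 2 = 1 ->
     forall m, m \in densenet_mats d L nd ->
       jacobian_moments (all_coords (densenet_mats d L nd))
         (densenet d L nd alpha x)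
         (densenet_red d L nd alpha m.1.1 x) m.1.1 m.1.2 m.2).
Proof.
split=> [d n L mb nb alpha x _ mb_gt0 _ _ _ m|d L nd alpha x _ _ _ m].
  exact: resnet_moments.
exact: densenet_moments.
Qed.
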